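(* Let $\Delta>0$, let $\mathcal{G}$ be a family of finite graphs of connective constant at most $\Delta$, and let $\gamma>0$ be a fixed edge (dimer) activity. Then there is an FPTAS for the partition function of the monomer-dimer model with edge activity $\gamma$ for all graphs in $\mathcal{G}$. More specifically, the running time for producing a $(1\pm\epsilon)$-factor approximation on an $n$-vertex graph is $(n/\epsilon)^{O(\sqrt{\gamma\Delta}\log\Delta)}$.
   Context: Monomer-dimer model: for a graph $G=(V,E)$ and dimer activity $\gamma>0$, each matching $M$ of $G$ has weight $\gamma^{|M|}$ and the partition function is $Z_G(\gamma)=\sum_M\gamma^{|M|}$ over all matchings. An FPTAS is a deterministic algorithm that, given $G$ and $\epsilon\in(0,1]$, outputs $\hat Z$ with $(1-\epsilon)Z_G\le\hat Z\le(1+\epsilon)Z_G$ in time polynomial in $n$ and $1/\epsilon$. Let $N(v,\ell)$ be the number of self-avoiding walks of length $\ell$ starting at $v$. A family $\mathcal{F}$ of finite graphs has connective constant at most $\Delta$ if there are constants $a,c$ such that for every $G=(V,E)\in\mathcal{F}$, every $v\in V$ and all $\ell\ge a\log|V|$, $\sum_{i=1}^\ell N(v,i)\le c\Delta^\ell$.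
   Formalization: The explicit running time is claimed only for Δ>1 (at Δ≤1 its exponent is zero or negative and the bound fails); the O-constant may depend on a and on a lower bound δ for Δ−1 and γΔ; γ and ε are read through their binary digits. The FPTAS claim covers all Δ>0, γ>0. *)

(* Defs.v *)
From HB Require Import structures.
From mathcomp Require Import all_boot all_order all_algebra.
From mathcomp Require Import reals exp.

Set Implicit Arguments.
Unset Strict Implicit.
Unset Printing Implicit Defensive.

Import Order.TTheory GRing.Theory Num.Theory.
Local Open Scope ring_scope.

Record sgraph := SGraph {
  nv : nat;
  adj : rel 'I_nv;
  nv_gt0 : (0 < nv)%N;
  adj_sym : symmetric adj;
  adj_irr : irreflexive adj
}.

Definition edges (G : sgraph) : {set {set 'I_(nv G)}} :=
  [set A : {set 'I_(nv G)} | [exists x, exists y, adj x y && (A == [set x; y])]].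

(* All edges are nonempty, so [trivIset] says that distinct edges share no
   endpoint. *)
Definition matching (G : sgraph) (M : {set {set 'I_(nv G)}}) : bool :=
  (M \subset edges G) && trivIset M.

Definition partition_function (R : realType) (G : sgraph) (gamma : R) : R :=
  \sum_(M : {set {set 'I_(nv G)}} | matching M) gamma ^+ #|M|.

(* The walk is v :: w, which has l edges. *)
Definition num_saw (G : sgraph) (v : 'I_(nv G)) (l : nat) : nat :=
  #|[set w : l.-tuple 'I_(nv G) | path (@adj G) v w && uniq (v :: w)]|.

(* The family F has connective constant at most Delta, with witnesses a, c. *)
Definition connective_bound (R : realType) (a c Delta : R)
    (F : sgraph -> Prop) : Prop :=
  forall G : sgraph, F G ->
  forall (v : 'I_(nv G)) (l : nat), a * ln (nv G)%:R <= l%:R ->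
  (\sum_(1 <= i < l.+1) num_saw v i)%:R <= c * Delta ^+ l.

(* Model of computation: a first-order, call-by-value functional language with
   pairs and arbitrary-precision integers under the logarithmic (bit) cost
   criterion: a control or pointer operation costs 1, an arithmetic operation
   costs the product of the bit lengths of its operands (schoolbook).  It
   simulates, and is simulated by, a multitape Turing machine with polynomial
   overhead.

   The activity and the accuracy are arbitrary real numbers, so they are given
   to the program as in the oracle-machine model of real computation: a query
   with argument k returns the binary expansion up to 2^-k and costs at least
   k.  A program has no other access to real numbers. *)

Inductive value := VInt of int | VPair of value & value.

Inductive arith := OAdd | OSub | OMul | ODiv.

Inductive oracle_name := Activity | Accuracy.

Inductive expr :=
  | Var of nat                     (* de Bruijn index *)
  | Const of int
  | Arith of arith & expr & expr
  | Query of oracle_name & expr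
  | Pair of expr & expr
  | Fst of expr
  | Snd of expr
  | IsPair of expr
  | IfPos of expr & expr & expr
  | Let of expr & expr             (* the bound variable is index 0 *)
  | Call of nat & expr.            (* unary functions, mutually recursive *)

(* The list of the function bodies; the bodies live in a one-variable
   environment, and execution calls function 0 on the input. *)
Definition program := seq expr.

Definition bits (z : int) : nat := (trunc_log 2 `|z|%N).+1.

Definition arith_sem (o : arith) (x y : int) : int :=
  match o with
  | OAdd => x + y
  | OSub => x - y
  | OMul => x * y
  | ODiv => (x %/ y)%Z
  end.

(* [eval orc P env e v t]: e evaluates to v at total cost t. *)
Inductive eval (orc : oracle_name -> nat -> int) (P : program) :
    seq value -> expr -> value -> nat -> Prop :=
  | EVar env i : (i < size env)%N ->
      eval orc P env (Var i) (nth (VInt 0) env i) 1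
  | EConst env z : eval orc P env (Const z) (VInt z) (bits z)
  | EArith env o e1 e2 x y t1 t2 :
      eval orc P env e1 (VInt x) t1 -> eval orc P env e2 (VInt y) t2 ->
      eval orc P env (Arith o e1 e2) (VInt (arith_sem o x y))
        (t1 + t2 + bits x * bits y)%N
  | EQuery env q e (k : nat) t :
      eval orc P env e (VInt k%:Z) t ->
      eval orc P env (Query q e) (VInt (orc q k)) (t + k + bits (orc q k))%N
  | EPair env e1 e2 v1 v2 t1 t2 :
      eval orc P env e1 v1 t1 -> eval orc P env e2 v2 t2 ->
      eval orc P env (Pair e1 e2) (VPair v1 v2) (t1 + t2)%N.+1
  | EFst env e v1 v2 t :
      eval orc P env e (VPair v1 v2) t -> eval orc P env (Fst e) v1 t.+1
  | ESnd env e v1 v2 t :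
      eval orc P env e (VPair v1 v2) t -> eval orc P env (Snd e) v2 t.+1
  | EIsPairT env e v1 v2 t :
      eval orc P env e (VPair v1 v2) t -> eval orc P env (IsPair e) (VInt 1) t.+1
  | EIsPairF env e z t :
      eval orc P env e (VInt z) t -> eval orc P env (IsPair e) (VInt 0) t.+1
  | EIfPosT env e e1 e2 z v t t1 :
      eval orc P env e (VInt z) t -> 0 < z -> eval orc P env e1 v t1 ->
      eval orc P env (IfPos e e1 e2) v (t + t1)%N.+1
  | EIfPosF env e e1 e2 z v t t2 :
      eval orc P env e (VInt z) t -> z <= 0 -> eval orc P env e2 v t2 ->
      eval orc P env (IfPos e e1 e2) v (t + t2)%N.+1
  | ELet env e1 e2 v1 v t1 t2 :
      eval orc P env e1 v1 t1 -> eval orc P (v1 :: env) e2 v t2 ->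
      eval orc P env (Let e1 e2) v (t1 + t2)%N.+1
  | ECall env f e v1 v t1 t2 :
      (f < size P)%N ->
      eval orc P env e v1 t1 ->
      eval orc P [:: v1] (nth (Const 0) P f) v t2 ->
      eval orc P env (Call f e) v (t1 + t2)%N.+1.

(* Result and running time are functions of the program and of its input. *)
Lemma eval_det orc P env e v t v' t' :
  eval orc P env e v t -> eval orc P env e v' t' -> v = v' /\ t = t'.
Proof.
move=> H; elim: H v' t' => {env e v t}.
- by move=> env i _ v' t' H; inversion H.
- by move=> env z v' t' H; inversion H.
- move=> env o e1 e2 x y t1 t2 _ IH1 _ IH2 v' t' H; inversion H; subst.
  by case: (IH1 _ _ ltac:(eassumption)) => -[<-] <-;
     case: (IH2 _ _ ltac:(eassumption)) => -[<-] <-.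
- move=> env q e k t _ IH v' t' H; inversion H; subst.
  by case: (IH _ _ ltac:(eassumption)) => -[<-] <-.
- move=> env e1 e2 v1 v2 t1 t2 _ IH1 _ IH2 v' t' H; inversion H; subst.
  by case: (IH1 _ _ ltac:(eassumption)) => <- <-;
     case: (IH2 _ _ ltac:(eassumption)) => <- <-.
- move=> env e v1 v2 t _ IH v' t' H; inversion H; subst.
  by case: (IH _ _ ltac:(eassumption)) => -[<- _] <-.
- move=> env e v1 v2 t _ IH v' t' H; inversion H; subst.
  by case: (IH _ _ ltac:(eassumption)) => -[_ <-] <-.
- move=> env e v1 v2 t _ IH v' t' H; inversion H; subst.
    by case: (IH _ _ ltac:(eassumption)) => _ <-.
  by case: (IH _ _ ltac:(eassumption)).
- move=> env e z t _ IH v' t' H; inversion H; subst.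
    by case: (IH _ _ ltac:(eassumption)).
  by case: (IH _ _ ltac:(eassumption)) => _ <-.
- move=> env e e1 e2 z v t t1 _ IH z0 _ IH1 v' t' H; inversion H; subst.
    case: (IH _ _ ltac:(eassumption)) => _ <-.
    by case: (IH1 _ _ ltac:(eassumption)) => <- <-.
  case: (IH _ _ ltac:(eassumption)) => -[E] _; subst.
  by match goal with h : is_true (_ <= 0) |- _ => rewrite leNgt z0 in h end.
- move=> env e e1 e2 z v t t1 _ IH z0 _ IH1 v' t' H; inversion H; subst.
    case: (IH _ _ ltac:(eassumption)) => -[E] _; subst.
    by match goal with h : is_true (0 < _) |- _ => rewrite ltNge z0 in h end.
  case: (IH _ _ ltac:(eassumption)) => _ <-.
  by case: (IH1 _ _ ltac:(eassumption)) => <- <-.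
- move=> env e1 e2 v1 v t1 t2 _ IH1 _ IH2 v' t' H; inversion H; subst.
  case: (IH1 _ _ ltac:(eassumption)) => E <-; subst.
  by case: (IH2 _ _ ltac:(eassumption)) => <- <-.
- move=> env f e v1 v t1 t2 _ _ IH1 _ IH2 v' t' H; inversion H; subst.
  case: (IH1 _ _ ltac:(eassumption)) => E <-; subst.
  by case: (IH2 _ _ ltac:(eassumption)) => <- <-.
Qed.

Definition value_seq (s : seq value) : value := foldr VPair (VInt 0) s.

(* The number of vertices, followed by the adjacency matrix, row by row. *)
Definition graph_code (G : sgraph) : value :=
  VPair (VInt (nv G)%:Z)
    (value_seq [seq value_seq [seq VInt (adj i j : nat)%:Z | j <- enum 'I_(nv G)]
             | i <- enum 'I_(nv G)]).

Definition digits (R : realType) (gamma eps : R) (q : oracle_name) (k : nat) :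
    int :=
  Num.floor ((if q is Activity then gamma else eps) * 2 ^+ k).

(* P on (G, eps), for activity gamma, outputs the fraction num / den in time
   t. *)
Definition outputs_in_time (R : realType) (P : program) (gamma eps : R)
    (G : sgraph) (num den : int) (t : nat) : Prop :=
  eval (digits gamma eps) P [:: graph_code G] (Call 0 (Var 0))
    (VPair (VInt num) (VInt den)) t.

Definition approximates (R : realType) (eps Z Zhat : R) : Prop :=
  (1 - eps) * Z <= Zhat <= (1 + eps) * Z.

(* On every G in F and every eps in (0, 1], P outputs a (1 +- eps)-factor
   approximation of the partition function within time T n eps, where n is the
   number of vertices of G. *)
Definition approx_scheme (R : realType) (F : sgraph -> Prop) (gamma : R)
    (P : program) (T : nat -> R -> R) : Prop :=
  forall (G : sgraph) (eps : R), F G -> 0 < eps <= 1 ->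
  exists (num den : int) (t : nat),
    [/\ outputs_in_time P gamma eps G num den t,
        0 < den,
        approximates eps (partition_function G gamma) (num%:~R / den%:~R)
      & t%:R <= T (nv G) eps].

Definition is_fptas (R : realType) (F : sgraph -> Prop) (gamma : R)
    (P : program) : Prop :=
  exists (K : R) (d : nat),
    approx_scheme F gamma P (fun n eps => K * n%:R ^+ d * eps^-1 ^+ d).

(* Main.v *)
Require Import Defs.
From HB Require Import structures.
From mathcomp Require Import all_boot all_order all_algebra.
From mathcomp Require Import reals exp.
From mathcomp Require Import ring lra zify.

(* Write Z(A) for the partition function of the subgraph induced on A.  The
   ratios r(v, A) = Z(A + v) / Z(A) satisfy
     r(v, A) = 1 + gamma * \sum_(u in A, u ~ v) 1 / r(u, A - u),
   whose unfolding is indexed by the self-avoiding walks from v, and Z is the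
   product of n such ratios.  The program evaluates the recursion, truncated at
   depth l = O(sqrt (gamma Delta) * log (n / eps)), in exact rational
   arithmetic with gamma replaced by floor (2^l gamma) / 2^l, so that all costs
   are polynomial in the number O(Delta^l) of walks.

   Truncation is harmless because one step of the recursion contracts
   D(x, y) = |a - b| / sqrt (a b), where a = 2 x - 1 and b = 2 y - 1, in the
   following l^p sense: for every m >= 2,
     D^(m+1) <= 4 gamma / (m^2 - 1) * \sum_i D_i^(m+1).
   For m ~ 3 sqrt (gamma Delta) the factor is at most 1 / (2 Delta), so the
   c Delta^l leaves contribute at most c 2^-l times a polynomial in n to the
   power m + 1. *)

Set Implicit Arguments.
Unset Strict Implicit.
Unset Printing Implicit Defensive.

Import Order.TTheory GRing.Theory Num.Theory.
Local Open Scope ring_scope.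

(** * Contraction of the recursion *)

(** Degrees in the family are unbounded and only the total number of walks of each length is
    controlled. A step of the recursion may therefore be charged to the sum over the children but
    not to their number; a power sum whose coefficient does not depend on that number iterates to
    the coefficient to the power l times the number of walks.

    The substitution a = 2 x - 1 turns the recursion into a = 1 + 2 gamma \sum_i 1 / x_i, so
    Cauchy-Schwarz bounds sqrt (a b) from below by an expression of the same shape in the geometric
    means of x_i and y_i. Measuring D by differences, with a natural exponent m + 1, keeps every
    estimate algebraic: neither derivatives nor the mean value theorem occur.

    Since it is D^(m+1) that decays, reaching (eps / n)^(m+1) takes a depth proportional to m log (n
    / eps). This is how m, of order sqrt (gamma Delta), enters the exponent of the running time.

    Exact arithmetic is affordable because fractions are never reduced: up to a bounded factor per
    node, sizes multiply over the children, so bit lengths add up over the tree. *)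

Lemma eq_ler (R : numDomainType) (x y : R) : x = y -> x <= y.
Proof. by move->. Qed.

(** Convexity of the power function, as the position of its graph above the tangent at [y]. Both
    Jensen's and Bernoulli's inequalities below come from it. *)
Lemma expr_tangent (R : realFieldType) (n : nat) (x y : R) :
  0 <= x -> 0 <= y -> y ^+ n.+1 + n.+1%:R * y ^+ n * (x - y) <= x ^+ n.+1.
Proof.
move=> x0 y0; elim: n => [|n IH]; first by rewrite !expr0 !expr1; lra.
have [p0 q0] : 0 <= y ^+ n /\ 0 <= y ^+ n * (x - y) ^+ 2.
  by rewrite mulr_ge0 ?sqr_ge0 ?exprn_ge0.
rewrite (exprS x n.+1); apply: le_trans (ler_wpM2l x0 IH).
rewrite -[n.+2%:R]natr1 -[n.+1%:R]natr1 -subr_ge0 !exprS.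
have n0 : 0 <= (n%:R : R) by [].
have -> : x * (y * y ^+ n + (n%:R + 1) * y ^+ n * (x - y)) -
  (y * (y * y ^+ n) + (n%:R + 1 + 1) * (y * y ^+ n) * (x - y)) =
  (n%:R + 1) * (y ^+ n * (x - y) ^+ 2) by ring.
by rewrite mulr_ge0 // addr_ge0.
Qed.

(** The tangents at the weighted mean [c] are summed with weights [b i], and their linear terms
    cancel. The weights need not add up to 1, whence the total weight to the power [n]. *)
Lemma jensen_expr (R : realFieldType) (I : eqType) (r : seq I) (P : pred I)
    (b t : I -> R) (n : nat) :
  (forall i, P i -> 0 <= b i) -> (forall i, P i -> 0 <= t i) ->
  (\sum_(i <- r | P i) b i * t i) ^+ n.+1 <=
  (\sum_(i <- r | P i) b i) ^+ n * \sum_(i <- r | P i) b i * t i ^+ n.+1.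
Proof.
move=> b0 t0.
set B := \sum_(i <- r | P i) b i; set M := \sum_(i <- r | P i) b i * t i.
have B0 : 0 <= B by apply: sumr_ge0.
have M0 : 0 <= M by apply: sumr_ge0 => i Pi; rewrite mulr_ge0 ?b0 ?t0.
have [B_gt0|] := ltP 0 B; last first.
  move=> Ble; have M_0 : M = 0.
    have {}Ble : B = 0 by apply/le_anti; rewrite Ble.
    apply: big1_seq => i /andP[Pi ir].
    suff -> : b i = 0 by rewrite mul0r.
    apply/le_anti; rewrite b0 // andbT.
    by rewrite -Ble /B (big_rem i) //= Pi lerDl sumr_ge0.
  rewrite M_0 expr0n /= mulr_ge0 ?exprn_ge0 ?sumr_ge0 // => i Pi.
  by rewrite mulr_ge0 ?b0 ?exprn_ge0 ?t0.
set c := M / B.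
have c0 : 0 <= c by rewrite divr_ge0.
have MB : M = c * B by rewrite divfK ?gt_eqF.
have key : B * c ^+ n.+1 <= \sum_(i <- r | P i) b i * t i ^+ n.+1.
  apply: (@le_trans _ _ (\sum_(i <- r | P i)
      (b i * (c ^+ n.+1 - n.+1%:R * c ^+ n * c) +
       b i * t i * (n.+1%:R * c ^+ n)))).
    rewrite big_split /= -!mulr_suml -/B -/M MB.
    by apply: eq_ler; ring.
  apply: ler_sum => i Pi.
  have := ler_wpM2l (b0 i Pi) (expr_tangent n (t0 i Pi) c0).
  by apply: le_trans; apply: eq_ler; ring.
apply: le_trans (ler_wpM2l (exprn_ge0 n B0) key).
by apply: eq_ler; rewrite MB exprMn [B ^+ n.+1]exprS; ring.
Qed.

Lemma bernoulli_ge (R : realFieldType) (n : nat) (x : R) :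
  -1 <= x -> 1 + n%:R * x <= (1 + x) ^+ n.
Proof.
case: n => [|n] x1; first by rewrite mul0r addr0.
have := @expr_tangent R n (1 + x) 1 ltac:(lra) ltac:(lra).
rewrite !expr1n; lra.
Qed.

(** The extra [e] stands for the constant 1 of the recursion a = 1 + ... in both factors. Adding one
    index is the two-term case, which is AM-GM on the cross terms. *)
Lemma cauchy_schwarz_sqrt (R : rcfType) (I : Type) (r : seq I) (P : pred I)
    (f g : I -> R) (e : R) : 0 <= e ->
  (forall i, P i -> 0 <= f i) -> (forall i, P i -> 0 <= g i) ->
  e + \sum_(i <- r | P i) Num.sqrt (f i * g i) <=
  Num.sqrt ((e + \sum_(i <- r | P i) f i) * (e + \sum_(i <- r | P i) g i)).
Proof.
move=> e0 f0 g0.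
elim: r => [|i r IH]; first by rewrite !big_nil !addr0 -expr2 sqrtr_sqr ger0_norm.
rewrite !big_cons; case: ifP => // Pi.
move: IH; have := f0 i Pi; have := g0 i Pi.
set F := \sum_(j <- r | P j) f j; set G := \sum_(j <- r | P j) g j.
have F0 : 0 <= F by apply: sumr_ge0.
have G0 : 0 <= G by apply: sumr_ge0.
set S := \sum_(j <- r | P j) _.
move: (f i) (g i) => x y y0 x0 IH.
rewrite [e + (x + F)]addrCA [e + (y + G)]addrCA.
have eF : 0 <= e + F by rewrite addr_ge0.
have eG : 0 <= e + G by rewrite addr_ge0.
rewrite [e + (_ + S)]addrCA.
apply: (@le_trans _ _ (Num.sqrt (x * y) + Num.sqrt ((e + F) * (e + G)))).
  by rewrite lerD2l.
rewrite -(@ler_pXn2r _ 2) ?nnegrE ?addr_ge0 ?sqrtr_ge0 //.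
rewrite sqrrD !sqr_sqrtr ?mulr_ge0 ?addr_ge0 //.
rewrite -sqrtrM ?mulr_ge0 //.
have -> : (x + (e + F)) * (y + (e + G)) =
  x * y + (x * (e + G) + (e + F) * y) + (e + F) * (e + G) by ring.
rewrite lerD2r lerD2l.
set u := x * (e + G); set v := (e + F) * y.
have -> : x * y * ((e + F) * (e + G)) = u * v by rewrite /u /v; ring.
have u0 : 0 <= u by rewrite mulr_ge0.
have v0 : 0 <= v by rewrite mulr_ge0.
rewrite sqrtrM // mulr2n.
have := sqr_ge0 (Num.sqrt u - Num.sqrt v).
rewrite sqrrB !sqr_sqrtr // mulr2n; lra.
Qed.

(* On [a = 2x - 1] this is [|a - b| / sqrt (a * b)], i.e. twice the hyperbolic
   sine of half the distance between [ln a] and [ln b]. *)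
Definition ratio_dist (R : rcfType) (x y : R) : R :=
  2 * `|x - y| / Num.sqrt ((2 * x - 1) * (2 * y - 1)).

Lemma ratio_dist_ge0 (R : rcfType) (x y : R) : 0 <= ratio_dist x y.
Proof. by rewrite /ratio_dist divr_ge0 ?sqrtr_ge0 ?mulr_ge0. Qed.

(** For [p = 1 / x] and [T = 2 X - 1], this is the absolute value of the derivative of ln (2 X - 1)
    in ln (2 x - 1). For two different points, [p] becomes the inverse of their geometric mean. *)
Definition influence (R : rcfType) (g T p : R) : R := g * p * (2 - p) / T.

(** The denominator of the new distance is at least [T] by Cauchy-Schwarz ([hT]). In the numerator,
    each 1 / x - 1 / y is expressed by the old distance through sqrt ((2 x - 1) (2 y - 1)) <= 2 sqrt
    (x y) - 1 ([qle]), which is AM-GM. *)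
Lemma ratio_dist_step (R : rcfType) (I : Type) (r : seq I) (P : pred I)
    (g T : R) (x y p : I -> R) :
  0 < g -> (forall i, P i -> 1 <= x i) -> (forall i, P i -> 1 <= y i) ->
  (forall i, p i = (Num.sqrt (x i * y i))^-1) ->
  T = 1 + 2 * g * \sum_(i <- r | P i) p i ->
  ratio_dist (1 + g * \sum_(i <- r | P i) (x i)^-1)
             (1 + g * \sum_(i <- r | P i) (y i)^-1) <=
  \sum_(i <- r | P i) influence g T (p i) * ratio_dist (x i) (y i).
Proof.
move=> g0 x1 y1 pE TE.
have T1 : 1 <= T.
  rewrite TE lerDl mulr_ge0 ?sumr_ge0 // => [|i _]; first lra.
  by rewrite pE invr_ge0 sqrtr_ge0.
set X := 1 + _; set Y := 1 + _.
have hT : T <= Num.sqrt ((2 * X - 1) * (2 * Y - 1)).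
  have := @cauchy_schwarz_sqrt R I r P (fun i => 2 * g * (x i)^-1)
    (fun i => 2 * g * (y i)^-1) 1 ler01.
  have -> : 2 * X - 1 = 1 + \sum_(i <- r | P i) 2 * g * (x i)^-1.
    by rewrite -mulr_sumr /X; ring.
  have -> : 2 * Y - 1 = 1 + \sum_(i <- r | P i) 2 * g * (y i)^-1.
    by rewrite -mulr_sumr /Y; ring.
  have -> : T = 1 + \sum_(i <- r | P i)
      Num.sqrt (2 * g * (x i)^-1 * (2 * g * (y i)^-1)).
    rewrite TE mulr_sumr; congr (_ + _); apply: eq_bigr => i Pi.
    have -> : 2 * g * (x i)^-1 * (2 * g * (y i)^-1) =
       (2 * g) ^+ 2 * (x i * y i)^-1 by rewrite invfM; ring.
    rewrite sqrtrM ?sqr_ge0 // sqrtr_sqr ger0_norm ?sqrtrV ?pE //; last lra.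
    by rewrite mulr_ge0 //; have := x1 i Pi; have := y1 i Pi; lra.
  apply=> i Pi; rewrite mulr_ge0 ?invr_ge0 //;
    have := x1 i Pi; have := y1 i Pi; lra.
have hXY : 2 * `|X - Y| <=
    \sum_(i <- r | P i) (g * p i * (2 - p i)) * ratio_dist (x i) (y i).
  have -> : X - Y = g * \sum_(i <- r | P i) ((x i)^-1 - (y i)^-1).
    by rewrite sumrB /X /Y; ring.
  rewrite normrM (gtr0_norm g0) mulrA.
  apply: le_trans (ler_wpM2l _ (ler_norm_sum _ _ _)) _; first by lra.
  rewrite mulr_sumr; apply: ler_sum => i Pi.
  have xi := x1 i Pi; have yi := y1 i Pi.
  have s1 : 1 <= Num.sqrt (x i * y i).
    by rewrite -[X in X <= _]sqrtr1 ler_sqrt; nra.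
  have ss : Num.sqrt (x i * y i) ^+ 2 = x i * y i by rewrite sqr_sqrtr //; nra.
  have q0 : 0 < Num.sqrt ((2 * x i - 1) * (2 * y i - 1)).
    by rewrite sqrtr_gt0 mulr_gt0; lra.
  have qle : Num.sqrt ((2 * x i - 1) * (2 * y i - 1)) <=
      2 * Num.sqrt (x i * y i) - 1.
    rewrite -(@ler_pXn2r _ 2) ?nnegrE ?sqrtr_ge0 //; last lra.
    rewrite sqr_sqrtr; last by rewrite mulr_ge0; lra.
    rewrite sqrrB expr1n exprMn ss.
    suff : 2 * Num.sqrt (x i * y i) <= x i + y i by lra.
    rewrite sqrtrM; last lra.
    have := sqr_ge0 (Num.sqrt (x i) - Num.sqrt (y i)).
    rewrite sqrrB !sqr_sqrtr; lra.
  have -> : (x i)^-1 - (y i)^-1 = (y i - x i) / (x i * y i).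
    by field; rewrite !gt_eqF //; lra.
  rewrite normrM distrC normfV [X in _ / X]ger0_norm; last by nra.
  rewrite /ratio_dist pE.
  set s := Num.sqrt (x i * y i) in s1 ss qle *.
  set q := Num.sqrt _ in q0 qle *.
  rewrite -ss; set d := `|x i - y i|.
  have d0 : 0 <= d by exact: normr_ge0.
  have -> : g * s^-1 * (2 - s^-1) * (2 * d / q) =
    2 * g * (d / s ^+ 2) * ((2 * s - 1) / q).
    by field; rewrite !gt_eqF //; lra.
  rewrite ler_peMr // ?ler_pdivlMr ?mul1r //.
  by rewrite !mulr_ge0 ?invr_ge0 ?exprn_ge0 //; lra.
have q0 : 0 < Num.sqrt ((2 * X - 1) * (2 * Y - 1)) by apply: lt_le_trans hT; lra.
rewrite /ratio_dist ler_pdivrMr //.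
apply: le_trans hXY _.
have -> : \sum_(i <- r | P i) influence g T (p i) * ratio_dist (x i) (y i) =
   (\sum_(i <- r | P i) g * p i * (2 - p i) * ratio_dist (x i) (y i)) / T.
  by rewrite mulr_suml; apply: eq_bigr => i _; rewrite /influence mulrAC.
rewrite -mulrA ler_peMr //.
  apply: sumr_ge0 => i Pi; rewrite mulr_ge0 ?ratio_dist_ge0 //.
  have p0 : 0 <= p i by rewrite pE invr_ge0 sqrtr_ge0.
  have p1 : p i <= 1.
    rewrite pE invf_le1.
      rewrite -[X in X <= _]sqrtr1 ler_sqrt;
        have := x1 i Pi; have := y1 i Pi; nra.
    by rewrite sqrtr_gt0; have := x1 i Pi; have := y1 i Pi; nra.
  by rewrite !mulr_ge0; lra.
by rewrite mulrC ler_pdivlMr ?mul1r //; lra.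
Qed.

(** The number of summands does not enter, because a large sum of the [p i] makes [T] large and so
    each influence small. The trade-off ends in (1 - 1 / T)^m / T <= 1 / (m + 1). *)
Lemma influence_power_bound (R : rcfType) (I : eqType) (r : seq I) (P : pred I)
    (g T : R) (m : nat) (p d : I -> R) :
  0 < g -> (1 < m)%N -> (forall i, P i -> 0 <= p i <= 1) ->
  (forall i, P i -> 0 <= d i) ->
  T = 1 + 2 * g * \sum_(i <- r | P i) p i ->
  (\sum_(i <- r | P i) influence g T (p i) * d i) ^+ m.+1 <=
  4 * g / (m%:R ^+ 2 - 1) * \sum_(i <- r | P i) d i ^+ m.+1.
Proof.
move=> g0 m1 p01 d0 TE.
have Mgt : 2 <= m%:R :> R by rewrite ler_nat.
have S0 : 0 <= \sum_(i <- r | P i) p i.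
  by apply: sumr_ge0 => i /p01/andP[].
have T1 : 1 <= T by rewrite TE lerDl mulr_ge0 //; lra.
(* This scale gives [w i * e i] = (1 - 1 / m) (w + w^2 T / (4 g)) with w = [w i]. The quadratic term
   there is small enough to be absorbed by the loss of g p^2 / T in w against 2 g p / T. *)
pose z := 4 * g / (T * (m%:R - 1)).
have z0 : 0 < z by rewrite /z divr_gt0 ?mulr_gt0 //; lra.
pose w i := influence g T (p i).
have w0 i : P i -> 0 <= w i.
  move=> /p01/andP[a b]; rewrite /w /influence divr_ge0 ?mulr_ge0 //; lra.
(* These weights make Jensen's inequality as good as Hoelder's with exponent
   [m.+1] while [\sum_i w i * e i] stays computable. *)
pose e i := 1 + m%:R^-1 * (w i / z - 1).
have wz0 i : P i -> 0 <= w i / z by move=> Pi; rewrite divr_ge0 ?w0 // ltW.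
have mi : 0 < (m%:R^-1 : R) <= 2^-1.
  by rewrite invr_gt0 lef_pV2 ?posrE ?Mgt ?andbT; lra.
have e0 i : P i -> 0 < e i by move=> /wz0; rewrite /e; nra.
have eB i : P i -> w i / z <= e i ^+ m.
  move=> /wz0 wz; have := @bernoulli_ge R m (m%:R^-1 * (w i / z - 1)) ltac:(nra).
  rewrite mulrA divff ?mul1r; last by rewrite gt_eqF //; lra.
  by rewrite [X in X <= _]addrC subrK.
have -> : \sum_(i <- r | P i) influence g T (p i) * d i =
    \sum_(i <- r | P i) (w i * e i) * (d i / e i).
  by apply: eq_bigr => i Pi; rewrite mulrACA divff ?mulr1 // gt_eqF ?e0.
apply: le_trans (jensen_expr _ _ _ _) _.
- by move=> i Pi; rewrite mulr_ge0 ?w0 ?ltW ?e0.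
- by move=> i Pi; rewrite divr_ge0 ?d0 ?ltW ?e0.
have hsum : \sum_(i <- r | P i) w i * e i * (d i / e i) ^+ m.+1 <=
    z * \sum_(i <- r | P i) d i ^+ m.+1.
  rewrite mulr_sumr; apply: ler_sum => i Pi.
  have ei := e0 i Pi; have := eB i Pi.
  rewrite ler_pdivrMr // => le.
  have -> : w i * e i * (d i / e i) ^+ m.+1 = w i / e i ^+ m * d i ^+ m.+1.
    rewrite expr_div_n [e i ^+ m.+1]exprS; field.
    by rewrite expf_neq0 gt_eqF.
  by rewrite ler_wpM2r ?exprn_ge0 ?d0 // ler_pdivrMr ?exprn_gt0 // mulrC.
have hB : \sum_(i <- r | P i) w i * e i <= 1 - T^-1.
  apply: (@le_trans _ _ (\sum_(i <- r | P i) 2 * g / T * p i)); last first.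
    rewrite -mulr_sumr.
    have -> : \sum_(i <- r | P i) p i = (T - 1) / (2 * g).
      by rewrite TE; field; rewrite gt_eqF.
    by apply: eq_ler; field; rewrite !gt_eqF //; lra.
  apply: ler_sum => i Pi; have /andP[p0 p1] := p01 i Pi.
  have -> : w i * e i = (1 - m%:R^-1) *
     (w i + w i ^+ 2 * T / (4 * g)).
    rewrite /e /z; field; rewrite !gt_eqF //; lra.
  have h : w i + w i ^+ 2 * T / (4 * g) <= 2 * g / T * p i.
    have -> : w i + w i ^+ 2 * T / (4 * g) =
       g * p i / T * (2 - p i + p i * ((2 - p i) / 2) ^+ 2).
      by rewrite /w /influence; field; rewrite !gt_eqF //; lra.
    have -> : 2 * g / T * p i = g * p i / T * 2 by ring.
    apply: ler_wpM2l; first by rewrite divr_ge0 ?mulr_ge0; lra.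
    have : ((2 - p i) / 2) ^+ 2 <= 1 by apply: exprn_ile1; lra.
    nra.
  have h0 : 0 <= w i + w i ^+ 2 * T / (4 * g).
    have ww := sqr_ge0 (w i); rewrite addr_ge0 ?w0 // divr_ge0 //; last lra.
    by rewrite mulr_ge0 //; lra.
  apply: le_trans h; rewrite ler_piMl //; lra.
have hBm : (\sum_(i <- r | P i) w i * e i) ^+ m * z <= 4 * g / (m%:R ^+ 2 - 1).
  apply: (@le_trans _ _ ((1 - T^-1) ^+ m * z)).
    rewrite ler_wpM2r ?(ltW z0) // lerXn2r ?nnegrE //.
      by apply: sumr_ge0 => i Pi; rewrite mulr_ge0 ?w0 ?ltW ?e0.
    by rewrite subr_ge0 invf_le1 //; lra.
  have -> : 4 * g / (m%:R ^+ 2 - 1) = 4 * g / (m%:R - 1) / (m%:R + 1).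
    by field; rewrite !gt_eqF //; nra.
  have -> : (1 - T^-1) ^+ m * z = 4 * g / (m%:R - 1) * ((1 - T^-1) ^+ m / T).
    by rewrite /z; field; rewrite !gt_eqF //; lra.
  apply: ler_wpM2l; first by rewrite divr_ge0; lra.
  (* For [T = 1] the left side is 0 because [m] is positive. Otherwise Bernoulli at 1 / (T - 1)
     applies, and what remains is (T - 1)^2 + m >= 0. *)
  have [->|Tn1] := eqVneq T 1.
    rewrite invr1 subrr expr0n; case: (m) m1 => // k _.
    by rewrite mul0r invr_ge0 addr_ge0.
  have Tgt : 1 < T by rewrite lt_neqAle eq_sym Tn1.
  have v0 : 0 < (T - 1)^-1 by rewrite invr_gt0; lra.
  have := @bernoulli_ge R m ((T - 1)^-1) ltac:(lra).
  have -> : 1 + (T - 1)^-1 = (1 - T^-1)^-1.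
    by field; rewrite !gt_eqF //; lra.
  have u0 : 0 < 1 - T^-1 by rewrite subr_gt0 invf_lt1 //; lra.
  rewrite exprVn -[X in X <= _]invrK lef_pV2 ?posrE ?exprn_gt0 ?invr_gt0 //; last nra.
  move=> le; apply: (@le_trans _ _ ((1 + m%:R * (T - 1)^-1)^-1 / T)).
    by rewrite ler_wpM2r // invr_ge0; lra.
  have -> : (1 + m%:R * (T - 1)^-1)^-1 / T = (T - 1) / (T * (T - 1 + m%:R)).
    by field; rewrite !gt_eqF //; nra.
  rewrite ler_pdivrMr; last by rewrite mulr_gt0; lra.
  rewrite mulrC ler_pdivlMr; last lra.
  have := sqr_ge0 (T - 1); nra.
apply: le_trans (ler_wpM2l _ hsum) _.
  by apply: exprn_ge0; apply: sumr_ge0 => i Pi; rewrite mulr_ge0 ?w0 ?ltW ?e0.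
rewrite mulrA ler_wpM2r // sumr_ge0 // => i Pi; exact: exprn_ge0 (d0 i Pi).
Qed.

(** * Matchings and self-avoiding walks *)

Definition sub_partition (R : realType) (G : sgraph) (g : R)
    (A : {set 'I_(nv G)}) : R :=
  \sum_(M : {set {set 'I_(nv G)}} | matching M && (cover M \subset A))
    g ^+ #|M|.

Lemma sub_partitionT (R : realType) (G : sgraph) (g : R) :
  sub_partition g [set: 'I_(nv G)] = partition_function G g.
Proof. by apply: eq_bigl => M; rewrite subsetT andbT. Qed.

Lemma matching_nonempty (G : sgraph) (M : {set {set 'I_(nv G)}}) :
  matching M -> set0 \notin M.
Proof.
case/andP=> /subsetP ME _; apply/negP => /ME.
rewrite inE => /existsP[x /existsP[y /andP[_ /eqP/setP/(_ x)]]].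
by rewrite !inE eqxx.
Qed.

Lemma matching0 (G : sgraph) : @matching G set0.
Proof. by rewrite /matching sub0set; apply/trivIsetP => A B; rewrite inE. Qed.

Lemma sub_partition0 (R : realType) (G : sgraph) (g : R) :
  sub_partition g (set0 : {set 'I_(nv G)}) = 1.
Proof.
rewrite /sub_partition (big_pred1 set0) ?cards0 // => M /=.
apply/andP/eqP => [[mM]|->]; last by rewrite matching0 /cover big_set0 sub0set.
rewrite subset0 => /eqP c0; apply/setP => B; rewrite inE; apply/negP => BM.
have : B \subset cover M by apply: bigcup_sup.
rewrite c0 subset0 => /eqP B0; have := matching_nonempty mM.
by rewrite -B0 BM.
Qed.

Lemma sub_partition_ge1 (R : realType) (G : sgraph) (g : R)
    (A : {set 'I_(nv G)}) : 0 <= g -> 1 <= sub_partition g A.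
Proof.
move=> g0; rewrite /sub_partition (bigD1 set0) /=; last first.
  by rewrite matching0 /cover big_set0 sub0set.
by rewrite cards0 lerDl sumr_ge0 // => M _; rewrite exprn_ge0.
Qed.

Lemma edge_in (G : sgraph) (u v : 'I_(nv G)) : adj v u -> [set v; u] \in edges G.
Proof.
by move=> h; rewrite inE; apply/existsP; exists v; apply/existsP; exists u;
  rewrite h eqxx.
Qed.

(** Deleting the edge at [v] maps the matchings that use it bijectively onto the matchings inside
    [A :\ u]. The form as an equality of booleans is the one that a reindexed sum asks for. *)
Lemma setU1_edge_matching (G : sgraph) (A : {set 'I_(nv G)}) (u v : 'I_(nv G))
    (M : {set {set 'I_(nv G)}}) :
  v \notin A -> u \in A -> adj v u ->
  [&& matching ([set v; u] |: M), cover ([set v; u] |: M) \subset v |: A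
    & [set v; u] \notin M] =
  matching M && (cover M \subset A :\ u).
Proof.
move=> vA uA vu; set e := [set v; u].
have ve : v \in e by rewrite !inE eqxx.
have ue : u \in e by rewrite !inE eqxx orbT.
apply/and3P/andP => [[m c eM]|[m c]].
  have [/subsetP mE /trivIsetP mT] := andP m.
  have mM : matching M.
    apply/andP; split; first by apply/subsetP => B BM; rewrite mE // !inE BM orbT.
    by apply: trivIsetS (subsetUr [set e] M) _; apply/trivIsetP.
  split=> //; apply/bigcupsP => B BM.
  have BeM : B \in e |: M by rewrite !inE BM orbT.
  have dj : [disjoint B & e].
    apply: mT => //; first by rewrite !inE eqxx.
    by apply: contraNneq eM => <-.
  apply/subsetP => x xB.
  have xc : x \in cover (e |: M) by apply/bigcupP; exists B.
  have := subsetP c _ xc; rewrite !inE.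
  have xe : x \notin e by rewrite (disjointFr dj).
  by move: xe; rewrite !inE negb_or => /andP[/negbTE-> ->].
have [mE mT] := andP m.
have dj : {in M, forall B : {set 'I_(nv G)}, [disjoint e & B]}.
  move=> B BM; rewrite disjoint_subset; apply/subsetP => x; rewrite !inE => xe.
  apply/negP => xB.
  have := subsetP c x; rewrite !inE.
  have -> : x \in cover M by apply/bigcupP; exists B.
  move=> /(_ isT)/andP[xu xA]; move: xe; rewrite (negbTE xu) orbF => /eqP xv.
  by move: vA; rewrite -xv xA.
have [T eM] := trivIsetU1 dj mT (matching_nonempty m).
split=> //.
  rewrite /matching T andbT; apply/subsetP => B; rewrite in_setU1.
  by case/predU1P=> [->|BM]; [exact: edge_in | exact: (subsetP mE)].
apply/bigcupsP => B; rewrite in_setU1 => /predU1P[->|BM].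
  by apply/subsetP => x; rewrite !inE => /orP[->//|/eqP->]; rewrite uA orbT.
apply: subset_trans (bigcup_sup _ BM) (subset_trans c _).
by apply: subset_trans (subsetUr _ _); apply: subsetDl.
Qed.

(** A matching either leaves [v] uncovered or contains exactly one edge at [v]; the matchings of the
    second kind are sorted by the other endpoint of that edge. *)
Lemma sub_partition_rec (R : realType) (G : sgraph) (g : R)
    (A : {set 'I_(nv G)}) (v : 'I_(nv G)) : v \notin A ->
  sub_partition g (v |: A) =
  sub_partition g A + g * \sum_(u in A | adj v u) sub_partition g (A :\ u).
Proof.
move=> vA; rewrite {1}/sub_partition (bigID (fun M => v \notin cover M)) /=.
congr (_ + _).
  apply: eq_bigl => M; rewrite -andbA; congr (_ && _).
  apply/andP/idP => [[c vM]|c].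
    apply/subsetP => x xM; have := subsetP c x xM; rewrite !inE.
    by case: eqP => // xv; move: vM; rewrite -xv xM.
  split; first by apply: subset_trans c (subsetUr _ _).
  by apply: contra vA; apply: (subsetP c).
(* The partner of [v] in [M]. By [pP], the default value [v] is never met on a matching that covers
   [v]. *)
pose p (M : {set {set 'I_(nv G)}}) :=
  odflt v [pick u | adj v u && ([set v; u] \in M)].
have edge_eq u u' : u != v -> [set v; u] = [set v; u'] -> u = u'.
  move=> uv /setP/(_ u); rewrite !inE eqxx orbT (negbTE uv) /=.
  by move/esym/eqP.
have adj_neq u : adj v u -> u != v.
  by apply: contraTneq => ->; rewrite adj_irr.
have pP (M : {set {set 'I_(nv G)}}) : matching M -> v \in cover M ->
    adj v (p M) && ([set v; p M] \in M).
  case/andP=> /subsetP ME _ /bigcupP[B BM vB]; rewrite /p.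
  case: pickP => //= none.
  have := ME _ BM; rewrite inE => /existsP[x /existsP[y /andP[xy /eqP BE]]].
  move: vB; rewrite BE !inE => /orP[/eqP vx|/eqP vy].
    by have := none y; rewrite vx xy -BE BM.
  by have := none x; rewrite vy adj_sym xy setUC -BE BM.
rewrite (partition_big p (fun u => (u \in A) && adj v u)) /=; last first.
  move=> M /andP[/andP[mM cM]]; rewrite negbK => vM.
  have /andP[avp eM] := pP M mM vM; rewrite avp andbT.
  have : p M \in cover M by apply/bigcupP; exists [set v; p M];
    rewrite // !inE eqxx orbT.
  move/(subsetP cM); rewrite !inE; case/predU1P => // pv.
  by move: (adj_neq _ avp); rewrite pv eqxx.
rewrite mulr_sumr; apply: eq_bigr => u /andP[uA vu].
rewrite (eq_bigl (fun M => [&& matching M, cover M \subset v |: A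
    & [set v; u] \in M])); last first.
  move=> M /=; rewrite negbK; case mM: (matching M) => //=.
  rewrite -andbA; congr (_ && _).
  apply/andP/idP => [[vM /eqP pu]|eM]; first by rewrite -pu; case/andP: (pP M mM vM).
  have vM : v \in cover M by apply/bigcupP; exists [set v; u] => //; rewrite !inE eqxx.
  split=> //; have /andP[avp pM] := pP M mM vM.
  have [_ /trivIsetP mT] := andP mM.
  apply/eqP/(edge_eq (p M) u); first exact: adj_neq.
  apply/eqP/negPn/negP => ne.
  have := mT _ _ pM eM ne; move/(disjointFr)/(_ (_ : v \in [set v; p M])).
  by rewrite !inE eqxx => /(_ isT).
rewrite (reindex_onto (fun M => [set v; u] |: M)
  (fun M => M :\ [set v; u])) /=; last first.
  by move=> M /and3P[_ _ eM]; rewrite setD1K.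
rewrite mulr_sumr; apply: eq_big => M.
  rewrite -(setU1_edge_matching M vA uA vu) setU11 andbT -andbA.
  congr [&& _, _ & _].
  apply/eqP/idP => [<-|eM]; first by rewrite !inE eqxx.
  by rewrite setU1K.
case/andP => _ /eqP<-; rewrite setD1K ?setU11 //.
by rewrite [#|_ |: _|](cardsD1 [set v; u]) setU11 exprS.
Qed.

Definition vertex_ratio (R : realType) (G : sgraph) (g : R) (v : 'I_(nv G))
    (A : {set 'I_(nv G)}) : R :=
  sub_partition g (v |: A) / sub_partition g A.

Lemma vertex_ratio_rec (R : realType) (G : sgraph) (g : R) (v : 'I_(nv G))
    (A : {set 'I_(nv G)}) : 0 <= g -> v \notin A ->
  vertex_ratio g v A = 1 + g * \sum_(u in A | adj v u) (vertex_ratio g u (A :\ u))^-1.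
Proof.
move=> g0 vA; have pos B := lt_le_trans (@ltr01 R) (@sub_partition_ge1 R G g B g0).
rewrite /vertex_ratio sub_partition_rec // mulrDl divff ?gt_eqF ?pos //.
rewrite -mulrA mulr_suml; congr (_ + _ * _).
by apply: eq_bigr => u /andP[uA _]; rewrite invf_div setD1K.
Qed.

Lemma vertex_ratio_ge1 (R : realType) (G : sgraph) (g : R) (v : 'I_(nv G))
    (A : {set 'I_(nv G)}) : 0 <= g -> v \notin A -> 1 <= vertex_ratio g v A.
Proof.
move=> g0 vA; rewrite vertex_ratio_rec // lerDl mulr_ge0 // sumr_ge0 // => u _.
by rewrite invr_ge0 divr_ge0 // (le_trans ler01) ?sub_partition_ge1.
Qed.

Lemma vertex_ratio_le (R : realType) (G : sgraph) (g : R) (v : 'I_(nv G))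
    (A : {set 'I_(nv G)}) : 0 <= g -> v \notin A ->
  vertex_ratio g v A <= 1 + g * (nv G)%:R.
Proof.
move=> g0 vA; rewrite vertex_ratio_rec // lerD2l ler_wpM2l //.
apply: (@le_trans _ _ (\sum_(u in A | adj v u) 1)).
  apply: ler_sum => u /andP[uA _].
  have h : 1 <= vertex_ratio g u (A :\ u).
    by apply: vertex_ratio_ge1; rewrite // !inE eqxx.
  by rewrite invf_le1 // (lt_le_trans ltr01).
rewrite sumr_const ler_nat.
by apply: leq_trans (max_card _) _; rewrite card_ord.
Qed.

(** * The truncated recursion, the size of its tree and the decay of its error *)

Fixpoint trunc_ratio (R : realType) (G : sgraph) (g : R) (l : nat)
    (v : 'I_(nv G)) (A : {set 'I_(nv G)}) : R :=
  if l is l'.+1 then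
    1 + g * \sum_(u in A | adj v u) (trunc_ratio g l' u (A :\ u))^-1
  else 1.

Lemma trunc_ratio_ge1 (R : realType) (G : sgraph) (g : R) (l : nat)
    (v : 'I_(nv G)) (A : {set 'I_(nv G)}) :
  0 <= g -> 1 <= trunc_ratio g l v A.
Proof.
move=> g0; elim: l v A => [|l IH] v A //=.
rewrite lerDl mulr_ge0 // sumr_ge0 // => u _.
by rewrite invr_ge0 (le_trans ler01).
Qed.

(** Counts the leaves of [trunc_ratio] at depth exactly [l], that is, the walks from [v] whose
    further vertices are distinct and lie in [A]. *)
Fixpoint num_walks (G : sgraph) (l : nat) (v : 'I_(nv G))
    (A : {set 'I_(nv G)}) : nat :=
  if l is l'.+1 then (\sum_(u in A | adj v u) num_walks l' u (A :\ u))%N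
  else 1%N.

(** Walks are sorted by their first step [u]; prefixing [u] is injective on the walks counted by the
    recursive call. *)
Lemma num_walks_le_card (G : sgraph) (l : nat) (v : 'I_(nv G))
    (A : {set 'I_(nv G)}) :
  (num_walks l v A <= #|[set w : l.-tuple 'I_(nv G) |
     [&& path (@adj G) v w, uniq w & all [in A] w]]|)%N.
Proof.
elim: l v A => [|l IH] v A /=.
  by rewrite card_gt0; apply/set0Pn; exists [tuple of [::]]; rewrite in_set.
rewrite -[X in (_ <= X)%N]sum1_card.
rewrite (partition_big (@thead l _) (fun u => (u \in A) && adj v u)) /=; last first.
  move=> w; rewrite inE; case/tupleP: w => u w /= /and3P[/andP[vu _] _ /andP[uA _]].
  by rewrite theadE uA vu.
apply: leq_sum => u /andP[uA vu]; apply: leq_trans (IH u (A :\ u)) _.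
rewrite sum1_card.
have inj : injective (fun w : l.-tuple 'I_(nv G) => [tuple of u :: w]).
  by move=> w w' /(congr1 val) /= [] /val_inj.
rewrite -(card_imset _ inj); apply/subset_leq_card/subsetP => w' /imsetP[w].
rewrite inE => /and3P[pw uw aw] ->.
rewrite unfold_in /= in_set /= theadE eqxx vu pw uw uA !andbT /=.
apply/andP; split.
  by apply/negP => /(allP aw); rewrite !inE eqxx.
by apply/allP => x /(allP aw); rewrite !inE => /andP[].
Qed.

Lemma num_walks_le_saw (G : sgraph) (l : nat) (v : 'I_(nv G))
    (A : {set 'I_(nv G)}) : v \notin A -> (num_walks l v A <= num_saw v l)%N.
Proof.
move=> vA; apply: leq_trans (num_walks_le_card l v A) _.
apply/subset_leq_card/subsetP => w; rewrite !inE => /and3P[-> uw aw] /=.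
by rewrite uw andbT; apply: contra vA => /(allP aw).
Qed.

(** Counts all nodes of the recursion tree. It governs both the running time and the bit length of
    the result. *)
Fixpoint tree_size (G : sgraph) (l : nat) (v : 'I_(nv G))
    (A : {set 'I_(nv G)}) : nat :=
  if l is l'.+1 then (1 + \sum_(u in A | adj v u) tree_size l' u (A :\ u))%N
  else 1%N.

Lemma tree_size_gt0 (G : sgraph) (l : nat) (v : 'I_(nv G))
    (A : {set 'I_(nv G)}) : (0 < tree_size l v A)%N.
Proof. by case: l. Qed.

Lemma tree_size_sum (G : sgraph) (l : nat) (v : 'I_(nv G))
    (A : {set 'I_(nv G)}) :
  tree_size l v A = (\sum_(i < l.+1) num_walks i v A)%N.
Proof.
elim: l v A => [|l IH] v A; first by rewrite big_ord1.
rewrite big_ord_recl /= exchange_big /=; congr (_ + _)%N.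
by apply: eq_bigr => u _; rewrite IH.
Qed.

Lemma tree_size_le (G : sgraph) (l : nat) (v : 'I_(nv G))
    (A : {set 'I_(nv G)}) : v \notin A ->
  (tree_size l v A <= 1 + \sum_(1 <= i < l.+1) num_saw v i)%N.
Proof.
move=> vA; rewrite tree_size_sum big_ord_recl /= leq_add2l.
rewrite big_add1 /= big_mkord; apply: leq_sum => i _.
exact: num_walks_le_saw.
Qed.

(** Each level contributes one contraction factor, and summing over the children turns their
    [num_walks] into that of the parent. The last factor bounds the distance at a leaf, where 1 is
    compared with a ratio of at most [1 + g * (nv G)%:R]. *)
Lemma trunc_ratio_decay (R : realType) (G : sgraph) (g : R) (m l : nat)
    (v : 'I_(nv G)) (A : {set 'I_(nv G)}) :
  0 < g -> (1 < m)%N -> v \notin A ->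
  ratio_dist (trunc_ratio g l v A) (vertex_ratio g v A) ^+ m.+1 <=
  (4 * g / (m%:R ^+ 2 - 1)) ^+ l * (num_walks l v A)%:R *
  (1 + 2 * g * (nv G)%:R) ^+ m.+1.
Proof.
move=> g0 m1; set K := 4 * g / (m%:R ^+ 2 - 1); elim: l v A => [|l IH] v A vA.
  rewrite expr0 !mul1r lerXn2r ?nnegrE ?ratio_dist_ge0 //.
    by rewrite addr_ge0 ?mulr_ge0 //; lra.
  rewrite /= /ratio_dist; have y1 := vertex_ratio_ge1 (ltW g0) vA.
  have := vertex_ratio_le (ltW g0) vA.
  move: y1; set y := vertex_ratio g v A => y1 yle.
  rewrite distrC ger0_norm; last lra.
  have s1 : 1 <= Num.sqrt ((2 * 1 - 1) * (2 * y - 1)).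
    by rewrite -[X in X <= _]sqrtr1 ler_sqrt; lra.
  rewrite ler_pdivrMr; last by lra.
  apply: (@le_trans _ _ (1 + 2 * g * (nv G)%:R)); first by lra.
  by rewrite ler_peMr //; lra.
rewrite /= vertex_ratio_rec ?(ltW g0) //.
pose x u := trunc_ratio g l u (A :\ u); pose y u := vertex_ratio g u (A :\ u).
pose p u := (Num.sqrt (x u * y u))^-1.
have x1 u : (u \in A) && adj v u -> 1 <= x u.
  by move=> _; apply: trunc_ratio_ge1; rewrite ltW.
have y1 u : (u \in A) && adj v u -> 1 <= y u.
  by move=> _; apply: vertex_ratio_ge1; rewrite ?ltW // !inE eqxx.
set T := 1 + 2 * g * \sum_(u in A | adj v u) p u.
have := @ratio_dist_step R _ (index_enum _) (fun u => (u \in A) && adj v u) g T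
  x y p g0 x1 y1 (fun=> erefl) erefl.
rewrite -/(trunc_ratio _ _ _ _) => h1.
have p01 u : (u \in A) && adj v u -> 0 <= p u <= 1.
  move=> hu; rewrite /p invr_ge0 sqrtr_ge0 /=.
  rewrite invf_le1.
    by rewrite -[X in X <= _]sqrtr1 ler_sqrt; have := x1 u hu; have := y1 u hu; nra.
  by rewrite sqrtr_gt0; have := x1 u hu; have := y1 u hu; nra.
have h2 := @influence_power_bound R _ (index_enum _)
  (fun u => (u \in A) && adj v u) g T m p
  (fun u => ratio_dist (x u) (y u)) g0 m1 p01
  (fun u _ => ratio_dist_ge0 (x u) (y u)) erefl.
have k0 : 0 <= K.
  have M2 : 2 <= m%:R :> R by rewrite ler_nat.
  by rewrite /K divr_ge0; nra.
apply: le_trans (_ : _ <= (_ : R)) (le_trans h2 _).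
  rewrite lerXn2r ?nnegrE ?ratio_dist_ge0 //.
  exact: le_trans (ratio_dist_ge0 _ _) h1.
rewrite -/K exprS -(mulrA K) -(mulrA K) ler_wpM2l //.
rewrite natr_sum mulr_sumr mulr_suml.
apply: ler_sum => u /andP[uA _].
by apply: IH; rewrite !inE eqxx.
Qed.

(** * The program *)

(** With an upper bound in place of the exact cost, the rules compose with the costs left as evars,
    and one use of [runs_le] at the end simplifies the total. *)
Definition runs (orc : oracle_name -> nat -> int) (P : program)
    (env : seq value) (e : expr) (v : value) (T : nat) : Prop :=
  exists2 t, (t <= T)%N & eval orc P env e v t.

Lemma runs_le orc P env e v T T' :
  runs orc P env e v T -> (T <= T')%N -> runs orc P env e v T'.
Proof. by move=> [t tT H] TT'; exists t => //; apply: leq_trans TT'. Qed.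

Lemma runs_var orc P env i v : (i < size env)%N -> nth (VInt 0) env i = v ->
  runs orc P env (Var i) v 1.
Proof. by move=> ? <-; exists 1%N => //; constructor. Qed.

Lemma runs_const orc P env z T : (bits z <= T)%N ->
  runs orc P env (Const z) (VInt z) T.
Proof. by move=> ?; exists (bits z) => //; constructor. Qed.

Lemma runs_arith orc P env o e1 e2 x y z b T1 T2 :
  runs orc P env e1 (VInt x) T1 -> runs orc P env e2 (VInt y) T2 ->
  arith_sem o x y = z -> (bits x <= b)%N -> (bits y <= b)%N ->
  runs orc P env (Arith o e1 e2) (VInt z) (T1 + T2 + b * b).
Proof.
move=> [t1 h1 H1] [t2 h2 H2] <- bx bb; exists (t1 + t2 + bits x * bits y)%N.
  by rewrite leq_add ?leq_mul // leq_add.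
exact: EArith.
Qed.

Lemma runs_add orc P env e1 e2 (x y : nat) b T1 T2 :
  runs orc P env e1 (VInt x) T1 -> runs orc P env e2 (VInt y) T2 ->
  (bits x <= b)%N -> (bits y <= b)%N ->
  runs orc P env (Arith OAdd e1 e2) (VInt (x + y)%N) (T1 + T2 + b * b).
Proof. by move=> H1 H2; apply: runs_arith H1 H2 _ => //=; rewrite PoszD. Qed.

Lemma runs_mul orc P env e1 e2 (x y : nat) b T1 T2 :
  runs orc P env e1 (VInt x) T1 -> runs orc P env e2 (VInt y) T2 ->
  (bits x <= b)%N -> (bits y <= b)%N ->
  runs orc P env (Arith OMul e1 e2) (VInt (x * y)%N) (T1 + T2 + b * b).
Proof. by move=> H1 H2; apply: runs_arith H1 H2 _ => //=; rewrite PoszM. Qed.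

Lemma runs_pred orc P env e (x : nat) b T :
  runs orc P env e (VInt x.+1) T -> (bits x.+1 <= b)%N ->
  runs orc P env (Arith OSub e (Const 1)) (VInt x) (T + 1 + b * b).
Proof.
move=> H1 bx; apply: (runs_arith H1 (@runs_const _ _ _ 1 1 isT)) => //=.
- by rewrite -addn1 PoszD addrK.
- exact: leq_trans bx.
Qed.

Lemma runs_succ orc P env e (x : nat) b T :
  runs orc P env e (VInt x) T -> (bits x <= b)%N ->
  runs orc P env (Arith OAdd e (Const 1)) (VInt x.+1) (T + 1 + b * b).
Proof.
move=> H1 bx; rewrite -addn1.
apply: (runs_add H1 (@runs_const _ _ _ 1 1 isT)) => //.
exact: leq_trans bx.
Qed.

Lemma runs_query orc P env q e (k : nat) b T :
  runs orc P env e (VInt k) T -> (bits (orc q k) <= b)%N ->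
  runs orc P env (Query q e) (VInt (orc q k)) (T + k + b).
Proof.
move=> [t h H] hb; exists (t + k + bits (orc q k))%N; first by rewrite !leq_add.
exact: EQuery.
Qed.

Lemma runs_pair orc P env e1 e2 v1 v2 T1 T2 :
  runs orc P env e1 v1 T1 -> runs orc P env e2 v2 T2 ->
  runs orc P env (Pair e1 e2) (VPair v1 v2) (T1 + T2).+1.
Proof.
move=> [t1 h1 H1] [t2 h2 H2]; exists (t1 + t2).+1; first by rewrite ltnS leq_add.
exact: EPair.
Qed.

Lemma runs_fst orc P env e v1 v2 T :
  runs orc P env e (VPair v1 v2) T -> runs orc P env (Fst e) v1 T.+1.
Proof. by move=> [t h H]; exists t.+1 => //; apply: EFst H. Qed.

Lemma runs_snd orc P env e v1 v2 T :
  runs orc P env e (VPair v1 v2) T -> runs orc P env (Snd e) v2 T.+1.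
Proof. by move=> [t h H]; exists t.+1 => //; apply: ESnd H. Qed.

Lemma runs_ifpos orc P env e e1 e2 z v T T' :
  runs orc P env e (VInt z) T ->
  (0 < z -> runs orc P env e1 v T') -> (z <= 0 -> runs orc P env e2 v T') ->
  runs orc P env (IfPos e e1 e2) v (T + T').+1.
Proof.
move=> [t h H] h1 h2; case: (ltP 0 z) => hz.
  case: (h1 hz) => t1 ht1 H1; exists (t + t1).+1; first by rewrite ltnS leq_add.
  exact: EIfPosT H hz H1.
case: (h2 hz) => t1 ht1 H1; exists (t + t1).+1; first by rewrite ltnS leq_add.
exact: EIfPosF H hz H1.
Qed.

Lemma runs_if_pair orc P env e e1 e2 v1 v2 v T T' :
  runs orc P env e (VPair v1 v2) T -> runs orc P env e1 v T' ->
  runs orc P env (IfPos (IsPair e) e1 e2) v (T + T').+2.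
Proof.
move=> [t h H] h1; rewrite -addSn; apply: (@runs_ifpos _ _ _ _ _ _ 1) => //.
by exists t.+1 => //; apply: EIsPairT H.
Qed.

Lemma runs_if_int orc P env e e1 e2 z v T T' :
  runs orc P env e (VInt z) T -> runs orc P env e2 v T' ->
  runs orc P env (IfPos (IsPair e) e1 e2) v (T + T').+2.
Proof.
move=> [t h H] h1; rewrite -addSn; apply: (@runs_ifpos _ _ _ _ _ _ 0) => //.
by exists t.+1 => //; apply: EIsPairF H.
Qed.

Lemma runs_if_pos orc P env e e1 e2 (x : nat) v T T' :
  runs orc P env e (VInt x.+1) T -> runs orc P env e1 v T' ->
  runs orc P env (IfPos e e1 e2) v (T + T').+1.
Proof. by move=> H H1; apply: runs_ifpos H _ _. Qed.

Lemma runs_if_zero orc P env e e1 e2 v T T' :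
  runs orc P env e (VInt 0) T -> runs orc P env e2 v T' ->
  runs orc P env (IfPos e e1 e2) v (T + T').+1.
Proof. by move=> H H1; apply: runs_ifpos H _ _. Qed.

Lemma runs_let orc P env e1 e2 v1 v T1 T2 :
  runs orc P env e1 v1 T1 -> runs orc P (v1 :: env) e2 v T2 ->
  runs orc P env (Let e1 e2) v (T1 + T2).+1.
Proof.
move=> [t1 h1 H1] [t2 h2 H2]; exists (t1 + t2).+1; first by rewrite ltnS leq_add.
exact: ELet H1 H2.
Qed.

Lemma runs_call orc P env f e v1 v T1 T2 :
  (f < size P)%N -> runs orc P env e v1 T1 ->
  runs orc P [:: v1] (nth (Const 0) P f) v T2 ->
  runs orc P env (Call f e) v (T1 + T2).+1.
Proof.
move=> fP [t1 h1 H1] [t2 h2 H2]; exists (t1 + t2).+1; first by rewrite ltnS leq_add.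
exact: ECall H1 H2.
Qed.

Ltac run_step :=
  lazymatch goal with
  | |- runs _ _ _ (Var _) _ _ => eapply runs_var; [reflexivity | reflexivity]
  | |- runs _ _ _ (Const _) _ _ => apply: (@runs_const _ _ _ _ 2); reflexivity
  | |- runs _ _ _ (Fst _) _ _ => eapply runs_fst
  | |- runs _ _ _ (Snd _) _ _ => eapply runs_snd
  | |- runs _ _ _ (Pair _ _) _ _ => eapply runs_pair
  end.
Ltac run_steps := repeat run_step.

Lemma bits_le (x b : nat) : (x < 2 ^ b)%N -> (0 < b)%N -> (bits x <= b)%N.
Proof.
move=> xb b0; rewrite /bits /=; case: x xb => [|x] xb; first by rewrite trunc_log0.
have := leq_ltn_trans (@trunc_logP 2 x.+1 isT isT) xb.
by rewrite ltn_exp2l.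
Qed.

Lemma bits_le_exp (x W : nat) : (x <= 2 ^ W)%N -> (bits x <= W.+1)%N.
Proof.
move=> xW; apply: bits_le => //; apply: leq_ltn_trans xW _.
by rewrite ltn_exp2l.
Qed.

Lemma bits_le_small (x W : nat) : (x <= W)%N -> (bits x <= W.+1)%N.
Proof.
by move=> xW; apply: bits_le_exp; apply: leq_trans xW (ltnW (ltn_expl _ _)).
Qed.

(** * The functions of the program *)

Definition fn_nth := 1%N.
Definition fn_rows := 2%N.
Definition fn_catrev := 3%N.
Definition fn_sum := 4%N.
Definition fn_tree := 5%N.
Definition fn_outer := 6%N.
Definition fn_log := 7%N.
Definition fn_prec := 8%N.
Definition fn_pow2 := 9%N.

Definition nth_body : expr :=
  let row := Fst (Var 0) in let j := Snd (Var 0) in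
  IfPos j (Call fn_nth (Pair (Snd row) (Arith OSub j (Const 1)))) (Fst row).

(* A vertex is represented by its index paired with its adjacency row. *)
Definition rows_body : expr :=
  let i := Fst (Var 0) in let rows := Snd (Var 0) in
  IfPos (IsPair rows)
    (Pair (Pair i (Fst rows))
       (Call fn_rows (Pair (Arith OAdd i (Const 1)) (Snd rows))))
    (Const 0).

Definition catrev_body : expr :=
  let s := Fst (Var 0) in let t := Snd (Var 0) in
  IfPos (IsPair s) (Call fn_catrev (Pair (Snd s) (Pair (Fst s) t))) t.

(* [dn] lists the vertices already scanned, in reverse order, and [td] those
   still to scan: [catrev dn td'] is then the vertex list without [u], and no
   equality test is needed to delete [u]. *)
Definition sum_body : expr :=
  let ctx a := Fst a in let lev a := Fst (Snd a) in
  let v a := Fst (Snd (Snd a)) in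
  let dn a := Fst (Snd (Snd (Snd a))) in
  let td a := Snd (Snd (Snd (Snd a))) in
  let a0 := Var 0 in let a1 := Var 1 in
  IfPos (IsPair (td a0))
    (Let (Call fn_sum (Pair (ctx a0) (Pair (lev a0) (Pair (v a0)
            (Pair (Pair (Fst (td a0)) (dn a0)) (Snd (td a0)))))))
      (IfPos (Call fn_nth (Pair (Snd (v a1)) (Fst (Fst (td a1)))))
        (Let (Call fn_tree (Pair (ctx a1) (Pair (lev a1) (Pair (Fst (td a1))
                (Call fn_catrev (Pair (dn a1) (Snd (td a1))))))))
          (Pair (Arith OAdd (Arith OMul (Fst (Var 1)) (Fst (Var 0)))
                            (Arith OMul (Snd (Var 0)) (Snd (Var 1))))
                (Arith OMul (Snd (Var 1)) (Fst (Var 0)))))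
        (Var 0)))
    (Pair (Const 0) (Const 1)).

(** The context [ctx] holds numerator and denominator of the rounded activity; it is passed down
    unchanged through all calls. *)
Definition tree_body : expr :=
  let ctx a := Fst a in let lev a := Fst (Snd a) in
  let v a := Fst (Snd (Snd a)) in let s a := Snd (Snd (Snd a)) in
  let a0 := Var 0 in let a1 := Var 1 in
  IfPos (lev a0)
    (Let (Call fn_sum (Pair (ctx a0) (Pair (Arith OSub (lev a0) (Const 1))
            (Pair (v a0) (Pair (Const 0) (s a0))))))
      (Let (Arith OMul (Snd (ctx a1)) (Snd (Var 0)))
        (Pair (Arith OAdd (Var 0) (Arith OMul (Fst (ctx (Var 2))) (Fst (Var 1))))
              (Var 0))))
    (Pair (Const 1) (Const 1)).

Definition outer_body : expr :=
  let ctx a := Fst a in let lev a := Fst (Snd a) in let s a := Snd (Snd a) in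
  let a0 := Var 0 in let a1 := Var 1 in
  IfPos (IsPair (s a0))
    (Let (Call fn_outer (Pair (ctx a0) (Pair (lev a0) (Snd (s a0)))))
      (Let (Call fn_tree (Pair (ctx a1) (Pair (lev a1)
              (Pair (Fst (s a1)) (Snd (s a1))))))
        (Pair (Arith OMul (Fst (Var 1)) (Fst (Var 0)))
              (Arith OMul (Snd (Var 1)) (Snd (Var 0))))))
    (Pair (Const 1) (Const 1)).

Definition log_body : expr :=
  IfPos (Arith OSub (Var 0) (Const 1))
    (Arith OAdd (Call fn_log (Arith ODiv (Var 0) (Const 2))) (Const 1))
    (Const 1).

(** Searches for the first k with eps 2^k >= 1. The program consults the accuracy nowhere else, so
    its output depends on eps through this k alone. *)
Definition prec_body : expr :=
  IfPos (Query Accuracy (Var 0)) (Var 0)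
    (Call fn_prec (Arith OAdd (Var 0) (Const 1))).

Definition pow2_body : expr :=
  IfPos (Var 0)
    (Arith OMul (Const 2) (Call fn_pow2 (Arith OSub (Var 0) (Const 1))))
    (Const 1).

(** The factor of [L1] is log2 (n / eps) up to an additive constant. The depth doubles as the
    precision of the activity, read as floor (2^l gamma) over 2^l. *)
Definition main_body (L0 L1 : nat) : expr :=
  Let (Arith OAdd (Const L0)
         (Arith OMul (Const L1)
            (Arith OAdd (Call fn_log (Fst (Var 0))) (Call fn_prec (Const 0)))))
   (Call fn_outer (Pair (Pair (Query Activity (Var 0)) (Call fn_pow2 (Var 0)))
      (Pair (Var 0) (Call fn_rows (Pair (Const 0) (Snd (Var 1))))))).

Definition approx_program (L0 L1 : nat) : program :=
  [:: main_body L0 L1; nth_body; rows_body; catrev_body; sum_body; tree_body;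
      outer_body; log_body; prec_body; pow2_body].

(** * Encodings, the fractions computed, and the cost of the auxiliary functions *)

Definition adj_row (G : sgraph) (v : 'I_(nv G)) : seq value :=
  [seq VInt (adj v j : nat) | j <- enum 'I_(nv G)].
Definition vertex (G : sgraph) (v : 'I_(nv G)) : value :=
  VPair (VInt (v : nat)) (value_seq (adj_row v)).
Definition vertices (G : sgraph) (s : seq 'I_(nv G)) : value :=
  value_seq (map (@vertex G) s).
Definition vfrac (r : nat * nat) : value := VPair (VInt r.1) (VInt r.2).

Lemma vertices_cons (G : sgraph) (v : 'I_(nv G)) s :
  vertices (v :: s) = VPair (vertex v) (vertices s).
Proof. by []. Qed.

(** The mathematical counterpart of [sum_body], on numerator-denominator pairs that are never
    reduced; [r] enters inverted. *)
Fixpoint sum_frac (G : sgraph) (tr : 'I_(nv G) -> seq 'I_(nv G) -> nat * nat)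
    (v : 'I_(nv G)) (dn td : seq 'I_(nv G)) : nat * nat :=
  if td is u :: td' then
    let q := sum_frac tr v (u :: dn) td' in
    if adj v u then
      let r := tr u (catrev dn td') in (q.1 * r.1 + r.2 * q.2, q.2 * r.1)%N
    else q
  else (0%N, 1%N).

Fixpoint tree_frac (G : sgraph) (g h l : nat) (v : 'I_(nv G))
    (s : seq 'I_(nv G)) : nat * nat :=
  if l is l'.+1 then
    let q := sum_frac (tree_frac g h l') v [::] s in
    (h * q.2 + g * q.1, h * q.2)%N
  else (1%N, 1%N).

(** The ratio of each vertex is taken relative to the vertices after it in the list, so the exact
    product would telescope to the partition function. *)
Fixpoint outer_frac (G : sgraph) (g h l : nat) (s : seq 'I_(nv G)) :
    nat * nat :=
  if s is v :: s' then
    let z := outer_frac g h l s' in let r := tree_frac g h l v s' in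
    (z.1 * r.1, z.2 * r.2)%N
  else (1%N, 1%N).

Section Runs.
Variables (orc : oracle_name -> nat -> int) (L0 L1 : nat).
Let P := approx_program L0 L1.

Lemma runs_nth (U : nat) (row : seq value) (j : nat) : (j < size row)%N ->
  (j < U)%N ->
  runs orc P [:: VPair (value_seq row) (VInt j)] nth_body
    (nth (VInt 0) row j) (j.+1 * (20 + U * U)).
Proof.
elim: j row => [|j IH] [|x row] //= hj hU.
  eapply runs_le; first by eapply runs_if_zero; run_steps.
  by lia.
eapply runs_le.
  eapply runs_if_pos; first by run_steps.
  eapply runs_call; [by [] | | by apply: IH; [exact: hj | exact: ltnW]].
  eapply runs_pair; first by run_steps.
  eapply (@runs_pred _ _ _ _ _ U); first by run_steps.
  by apply: leq_trans hU; apply: bits_le_small.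
by rewrite mulSn; lia.
Qed.

Lemma runs_catrev (G : sgraph) (s t : seq 'I_(nv G)) :
  runs orc P [:: VPair (vertices s) (vertices t)] catrev_body
    (vertices (catrev s t)) ((size s).+1 * 30).
Proof.
elim: s t => [|v s IH] t /=.
  eapply runs_le; first by eapply runs_if_int; run_steps.
  by lia.
rewrite vertices_cons; eapply runs_le.
  eapply runs_if_pair; first by run_steps.
  eapply runs_call; [by [] | | exact: (IH (v :: t))].
  by rewrite vertices_cons; run_steps.
by lia.
Qed.

Lemma runs_rows (G : sgraph) (U : nat) (i : nat) (s : seq 'I_(nv G)) :
  map val s = iota i (size s) -> (i + size s < U)%N ->
  runs orc P [:: VPair (VInt i) (value_seq [seq value_seq (adj_row v) | v <- s])]
    rows_body (vertices s) ((size s).+1 * (30 + U * U)).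
Proof.
elim: s i => [|v s IH] i /=.
  move=> _ _; eapply runs_le; first by eapply runs_if_int; run_steps.
  by lia.
case=> vi si hU; rewrite vertices_cons; eapply runs_le.
  eapply runs_if_pair; first by run_steps.
  eapply runs_pair; first by rewrite /vertex vi; run_steps.
  eapply runs_call; [by [] | | apply: (IH i.+1) => //; lia].
  eapply runs_pair; last by run_steps.
  eapply (@runs_succ _ _ _ _ _ U); first by run_steps.
  by apply: leq_trans (bits_le_small (leqnn _)) _; lia.
by lia.
Qed.

(** The number of halvings is bounded crudely by [n] itself, which is enough for a polynomial
    total. *)
Lemma runs_log (U n : nat) : (0 < n)%N -> (n < U)%N ->
  runs orc P [:: VInt n] log_body (VInt (trunc_log 2 n).+1)
    (n * (30 + 3 * (U * U))).
Proof.
elim/ltn_ind: n => n IH n0 nU.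
have hb x : (x <= n)%N -> (bits x <= U)%N.
  by move=> xn; apply: leq_trans (bits_le_small xn) _.
case: (ltnP 1 n) => n1; last first.
  have -> : n = 1%N by lia.
  rewrite trunc_log1; eapply runs_le.
    eapply runs_if_zero; last by run_steps.
    by eapply (@runs_pred _ _ _ _ 0 U); [run_steps | apply: hb].
  by lia.
have hh : n./2 = (n %/ 2)%N by rewrite divn2.
rewrite trunc_log2S // hh.
eapply runs_le.
  have [k nk] : exists k, n = k.+2 by exists n.-2; lia.
  eapply (@runs_if_pos _ _ _ _ _ _ k).
    eapply (@runs_pred _ _ _ _ k.+1 U); first by rewrite nk; run_steps.
    by apply: hb; lia.
  eapply (@runs_succ _ _ _ _ _ U).
  - eapply runs_call; [by [] | | by apply: IH; lia].
    eapply (@runs_arith _ _ _ _ _ _ n 2 _ U); [by run_steps|by run_steps| | |].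
    + by rewrite /= divz_nat.
    + exact: hb.
    + by apply: (hb 2%N); lia.
  - apply: hb; have n2 : (0 < n %/ 2)%N by lia.
    have := trunc_logP (isT : 1 < 2)%N n2.
    have := ltn_expl (trunc_log 2 (n %/ 2)) (isT : 1 < 2)%N.
    by lia.
by nia.
Qed.

Lemma runs_prec (U j : nat) (k : nat) :
  (forall i, (i < j)%N -> orc Accuracy i = 0) -> orc Accuracy j = 1 ->
  (k <= j)%N -> (j < U)%N ->
  runs orc P [:: VInt k] prec_body (VInt j) ((j - k).+1 * (30 + 2 * (U * U))).
Proof.
move=> h0 h1 kj jU; have [d jE] : exists d, j = (d + k)%N by exists (j - k)%N; lia.
elim: d k kj jE => [|d IH] k kj jE.
  rewrite add0n in jE; subst k; eapply runs_le.
    eapply (@runs_if_pos _ _ _ _ _ _ 0); last by run_steps.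
    rewrite -[VInt 1]/(VInt (1 : int)) -h1.
    by eapply (@runs_query _ _ _ _ _ _ 1); [run_steps | rewrite h1].
  by rewrite subnn mul1n; nia.
eapply runs_le.
  eapply runs_if_zero.
    rewrite -(h0 k); last by lia.
    by eapply (@runs_query _ _ _ _ _ _ 1); [run_steps | rewrite h0 //; lia].
  eapply runs_call; [by [] | | by apply: (IH k.+1); lia].
  eapply (@runs_succ _ _ _ _ _ U); first by run_steps.
  by apply: leq_trans (bits_le_small (leqnn _)) _; lia.
have -> : (j - k = (j - k.+1).+1)%N by lia.
by rewrite mulSn; nia.
Qed.

Lemma runs_pow2 (U l : nat) : (l < U)%N ->
  runs orc P [:: VInt l] pow2_body (VInt (2 ^ l)%N) (l.+1 * (30 + 2 * (U * U))).
Proof.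
elim: l => [|l IH] lU.
  by eapply runs_le; [eapply runs_if_zero; run_steps | lia].
eapply runs_le.
  eapply runs_if_pos; first by run_steps.
  rewrite expnS; eapply (@runs_mul _ _ _ _ _ 2 _ U); first by run_steps.
  - eapply runs_call; [by [] | | by apply: IH; lia].
    eapply (@runs_pred _ _ _ _ _ U); first by run_steps.
    by apply: leq_trans (bits_le_small (leqnn _)) _; lia.
  - by apply: leq_trans lU.
  - by apply: leq_trans (bits_le_exp (leqnn _)) _; lia.
by rewrite [in X in (_ <= X)%N]mulSn; nia.
Qed.

End Runs.

(** * Values and bit lengths of the fractions *)

Lemma set_catrev (T : finType) (A : {set T}) (dn td : seq T) (u : T) :
  uniq (dn ++ u :: td) -> A =i dn ++ u :: td ->
  [set x in catrev dn td] = A :\ u.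
Proof.
rewrite uniq_catC /= mem_cat negb_or => /andP[/andP[utd udn] _] hA.
apply/setP => x; rewrite !inE hA catrevE !mem_cat mem_rev inE.
by case: eqP => //= ->; rewrite (negbTE utd) (negbTE udn).
Qed.

Lemma uniq_catrev (T : eqType) (dn td : seq T) (u : T) :
  uniq (dn ++ u :: td) -> uniq (u :: catrev dn td).
Proof.
rewrite uniq_catC /= mem_cat catrevE mem_cat mem_rev orbC => /andP[->].
by rewrite uniq_catC !cat_uniq rev_uniq (eq_has (mem_rev dn)).
Qed.

Lemma mem_cat_shift (T : eqType) (dn td : seq T) (u : T) :
  dn ++ u :: td =i (u :: dn) ++ td.
Proof. by move=> x; rewrite !mem_cat !inE orbCA orbA. Qed.

Lemma uniq_cat_shift (T : eqType) (dn td : seq T) (u : T) :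
  uniq (dn ++ u :: td) = uniq ((u :: dn) ++ td).
Proof. exact: (uniq_catCA dn [:: u] td). Qed.

Lemma size_uniq_ord (n : nat) (s : seq 'I_n) : uniq s -> (size s <= n)%N.
Proof.
by move=> /card_uniqP<-; apply: leq_trans (max_card _) _; rewrite card_ord.
Qed.

(** There are at most [size td] summands, each the inverse of a fraction that is at least 1. *)
Lemma sum_frac_bounds (G : sgraph) (tr : 'I_(nv G) -> seq 'I_(nv G) -> nat * nat)
    (v : 'I_(nv G)) (dn td : seq 'I_(nv G)) :
  (forall u s, (0 < (tr u s).2 <= (tr u s).1)%N) ->
  (0 < (sum_frac tr v dn td).2)%N /\
  ((sum_frac tr v dn td).1 <= size td * (sum_frac tr v dn td).2)%N.
Proof.
move=> htr; elim: td dn => [|u td IH] dn //=.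
have [q0 q1] := IH (u :: dn); case: ifP => _ /=; last by split=> //; nia.
have /andP[r0 r1] := htr u (catrev dn td).
split; first by rewrite muln_gt0 q0 (leq_trans r0).
rewrite mulSn addnC leq_add //; first by rewrite mulnC leq_mul.
by rewrite mulnA leq_mul.
Qed.

Lemma tree_frac_bounds (G : sgraph) (g h l : nat) (v : 'I_(nv G)) s :
  (0 < h)%N ->
  (0 < (tree_frac g h l v s).2 <= (tree_frac g h l v s).1)%N.
Proof.
move=> h0; elim: l v s => [|l IH] v s //=.
have [q0 _] := sum_frac_bounds v [::] s IH.
by rewrite muln_gt0 h0 q0 leq_addr.
Qed.

(** The invariant is that [dn ++ td] enumerates [A]; moving [u] from [td] to [dn] preserves it. *)
Lemma sum_frac_val (R : realType) (G : sgraph)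
    (tr : 'I_(nv G) -> seq 'I_(nv G) -> nat * nat)
    (f : 'I_(nv G) -> {set 'I_(nv G)} -> R)
    (v : 'I_(nv G)) (A : {set 'I_(nv G)}) (dn td : seq 'I_(nv G)) :
  (forall u s, (0 < (tr u s).2 <= (tr u s).1)%N) ->
  (forall u s, uniq (u :: s) ->
     (tr u s).1%:R / (tr u s).2%:R = f u [set x in s]) ->
  uniq (dn ++ td) -> A =i dn ++ td ->
  (sum_frac tr v dn td).1%:R / (sum_frac tr v dn td).2%:R =
  \sum_(u <- td | adj v u) (f u (A :\ u))^-1.
Proof.
move=> htr hf; elim: td dn => [|u td IH] dn udn hA /=.
  by rewrite big_nil mul0r.
rewrite big_cons -(IH (u :: dn)); first 1 last.
- by rewrite -uniq_cat_shift.
- by move=> x; rewrite hA mem_cat_shift.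
have [q0 _] := sum_frac_bounds v (u :: dn) td htr.
case: ifP => _ //=; rewrite -(set_catrev udn hA) -hf ?uniq_catrev //.
have /andP[r0 r1] := htr u (catrev dn td); have r2 := leq_trans r0 r1.
by rewrite natrD !natrM; field; rewrite !pnatr_eq0 -!lt0n q0 r0 r2.
Qed.

Lemma big_seq_set (R : Type) (idx : R) (op : Monoid.com_law idx) (T : finType)
    (s : seq T) (P : pred T) (F : T -> R) : uniq s ->
  \big[op/idx]_(u <- s | P u) F u = \big[op/idx]_(u in [set x in s] | P u) F u.
Proof.
move=> us; rewrite big_mkcond /= big_uniq //= -big_mkcondr /=.
by apply: eq_bigl => u; rewrite inE.
Qed.

Lemma tree_frac_val (R : realType) (G : sgraph) (g h l : nat) (v : 'I_(nv G)) s :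
  (0 < h)%N -> uniq s ->
  (tree_frac g h l v s).1%:R / (tree_frac g h l v s).2%:R =
  trunc_ratio (g%:R / h%:R : R) l v [set x in s].
Proof.
move=> h0; elim: l v s => [|l IH] v s us; first by rewrite divr1.
have tb u s' := @tree_frac_bounds G g h l u s' h0.
have [q0 _] := sum_frac_bounds v [::] s tb.
have := @sum_frac_val R G (tree_frac g h l) (trunc_ratio (g%:R / h%:R : R) l) v
  [set x in s] [::] s tb.
rewrite big_seq_set //= => <- //; last first.
- by move=> x; rewrite inE.
- by move=> u s' /andP[_ us']; apply: IH.
by rewrite natrD !natrM; field; rewrite !pnatr_eq0 -!lt0n h0 q0.
Qed.

Lemma outer_frac_bounds (G : sgraph) (g h l : nat) (s : seq 'I_(nv G)) :
  (0 < h)%N -> (0 < (outer_frac g h l s).2 <= (outer_frac g h l s).1)%N.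
Proof.
move=> h0; elim: s => [|v s /andP[z0 z1]] //=.
have /andP[r0 r1] := tree_frac_bounds g l v s h0.
by rewrite muln_gt0 z0 r0 leq_mul.
Qed.

(** The denominator of the sum is the product of the numerators of the neighbours' fractions, so the
    exponents add. *)
Lemma sum_frac_le (G : sgraph) (tr : 'I_(nv G) -> seq 'I_(nv G) -> nat * nat)
    (f : 'I_(nv G) -> {set 'I_(nv G)} -> nat) (B : nat)
    (v : 'I_(nv G)) (A : {set 'I_(nv G)}) (dn td : seq 'I_(nv G)) :
  (forall u s, uniq (u :: s) -> ((tr u s).1 <= 2 ^ (B * f u [set x in s]))%N) ->
  uniq (dn ++ td) -> A =i dn ++ td ->
  ((sum_frac tr v dn td).2 <= 2 ^ (B * \sum_(u <- td | adj v u) f u (A :\ u)))%N.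
Proof.
move=> hf; elim: td dn => [|u td IH] dn udn hA /=.
  by rewrite big_nil muln0.
have := IH (u :: dn); rewrite -uniq_cat_shift => /(_ udn).
have hA' : A =i (u :: dn) ++ td by move=> x; rewrite hA mem_cat_shift.
move=> /(_ hA') {}IH; rewrite big_cons; case: ifP => _ //=.
rewrite mulnDr expnD mulnC leq_mul // -(set_catrev udn hA).
by apply: hf; apply: uniq_catrev.
Qed.

(** A node contributes one factor [h + g * nv G]: the sum of at most [nv G] inverses is at most
    [nv G], so h q.2 + g q.1 <= (h + g n) q.2. The result has about [B] bits per node of the
    tree. *)
Lemma tree_frac_le (G : sgraph) (g h l B : nat) (v : 'I_(nv G)) s :
  (0 < h)%N -> (h + g * nv G <= 2 ^ B)%N -> uniq s ->
  ((tree_frac g h l v s).1 <= 2 ^ (B * tree_size l v [set x in s]))%N.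
Proof.
move=> h0 hB; elim: l v s => [|l IH] v s us; first by rewrite /= expn_gt0.
have tb u s' := @tree_frac_bounds G g h l u s' h0.
have [q0 q1] := sum_frac_bounds v [::] s tb.
have := @sum_frac_le G (tree_frac g h l) (@tree_size G l) B v
  [set x in s] [::] s.
rewrite big_seq_set //= => hq.
have {}hq := hq (fun u s' us' => IH u s' (proj2 (andP us'))) us (fun x => in_set _ _).
rewrite mulnDr muln1 expnD; apply: leq_trans (leq_mul hB hq).
rewrite mulnDl leq_add2l -mulnA leq_mul2l; apply/orP; right.
by apply: leq_trans q1 _; rewrite leq_mul2r size_uniq_ord ?orbT.
Qed.

Lemma outer_frac_le (G : sgraph) (g h l B S : nat) (s : seq 'I_(nv G)) :
  (0 < h)%N -> (h + g * nv G <= 2 ^ B)%N -> uniq s ->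
  (forall (v : 'I_(nv G)) (A : {set 'I_(nv G)}),
     v \notin A -> (tree_size l v A <= S)%N) ->
  ((outer_frac g h l s).1 <= 2 ^ (B * S * size s))%N.
Proof.
move=> h0 hB us hS; elim: s us => [|v s IH] /=; first by rewrite expn_gt0.
case/andP=> vs us.
rewrite mulnS expnD mulnC leq_mul ?IH //.
apply: leq_trans (tree_frac_le l v h0 hB us) _.
by rewrite leq_exp2l // leq_mul2l hS ?orbT // inE.
Qed.

Definition tree_arg (G : sgraph) (g h l : nat) (v : 'I_(nv G))
    (s : seq 'I_(nv G)) : value :=
  VPair (VPair (VInt g) (VInt h))
    (VPair (VInt l) (VPair (vertex v) (vertices s))).

Lemma size_adj_row (G : sgraph) (v : 'I_(nv G)) : size (adj_row v) = nv G.
Proof. by rewrite size_map size_enum_ord. Qed.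

Lemma nth_adj_row (G : sgraph) (v u : 'I_(nv G)) :
  nth (VInt 0) (adj_row v) u = VInt (adj v u : nat).
Proof. by rewrite (nth_map u) ?size_enum_ord // nth_ord_enum. Qed.

(** * Cost of the recursion *)

Section Runs.
Variables (orc : oracle_name -> nat -> int) (L0 L1 : nat).
Variables (G : sgraph) (g h B W : nat).
Hypotheses (h_gt0 : (0 < h)%N) (hB : (h + g * nv G <= 2 ^ B)%N).
Hypotheses (nB : (nv G <= 2 ^ B)%N) (nW : (nv G <= W)%N).
Let P := approx_program L0 L1.
(** [U] bounds the bit length of every operand. [q] pays for one entry of a scan, where the lookup
    in the adjacency row costs order U^3; [Q] pays for a node together with its scan of at most
    [nv G] entries. *)
Let U := W.+1.
Let q := (400 * (U * U * U))%N.
Let Q := (900 * (U * U * U * U))%N.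

(** The first hypothesis is the induction hypothesis of [runs_tree]. The [.+1] in the size
    hypothesis leaves room for one more factor 2^B, since the numerator of a sum can exceed its
    denominator by a factor up to [nv G]. *)
Lemma runs_sum (l : nat) (v : 'I_(nv G)) (A : {set 'I_(nv G)}) dn td :
  (forall (u : 'I_(nv G)) s, uniq (u :: s) -> (B * tree_size l u [set x in s] <= W)%N ->
     runs orc P [:: tree_arg g h l u s] tree_body (vfrac (tree_frac g h l u s))
       (tree_size l u [set x in s] * Q)) ->
  uniq (dn ++ td) -> A =i dn ++ td ->
  (B * (\sum_(u <- td | adj v u) tree_size l u (A :\ u)).+1 <= W)%N ->
  runs orc P
    [:: VPair (VPair (VInt g) (VInt h)) (VPair (VInt l) (VPair (vertex v)
          (VPair (vertices dn) (vertices td))))]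
    sum_body (vfrac (sum_frac (tree_frac g h l) v dn td))
    ((\sum_(u <- td | adj v u) tree_size l u (A :\ u)) * Q + (size td).+1 * q).
Proof.
have U0 : (0 < U)%N by []; have UE : U = W.+1 by [].
have tb u s' := @tree_frac_bounds G g h l u s' h_gt0.
move=> htree; elim: td dn => [|u td IH] dn udn hA hW.
  rewrite big_nil; eapply runs_le; first by eapply runs_if_int; run_steps.
  by rewrite /q; nia.
have hA' : A =i (u :: dn) ++ td by move=> x; rewrite hA mem_cat_shift.
have udn' : uniq ((u :: dn) ++ td) by rewrite -uniq_cat_shift.
(* Serves numerators of sums, with [k] up to [nv G], as well as the other factors, with [k = 1]. *)
have fracW x y k : (x <= k * y)%N -> (k <= nv G)%N ->
    (y <= 2 ^ (B * \sum_(u <- u :: td | adj v u) tree_size l u (A :\ u)))%N ->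
    (bits x <= U)%N.
  move=> xy kn hy; apply: bits_le_exp; apply: leq_trans xy _.
  apply: leq_trans (leq_mul (leq_trans kn nB) hy) _.
  by rewrite -expnD -mulnS leq_exp2l.
have sz : ((size td).+1 <= nv G)%N.
  by apply: leq_trans (size_uniq_ord udn); rewrite size_cat /= leq_addl.
have szd : (size dn < nv G)%N.
  by apply: leq_trans (size_uniq_ord udn); rewrite size_cat /= addnS ltnS leq_addr.
have le_sum : (\sum_(u <- td | adj v u) tree_size l u (A :\ u) <=
    \sum_(u <- u :: td | adj v u) tree_size l u (A :\ u))%N.
  by rewrite big_cons; case: ifP => _ //; apply: leq_addl.
have sle s1 s2 : uniq (s1 ++ s2) -> A =i s1 ++ s2 ->
  ((sum_frac (tree_frac g h l) v s1 s2).2 <=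
    2 ^ (B * \sum_(u <- s2 | adj v u) tree_size l u (A :\ u)))%N.
  apply: sum_frac_le => w s /andP[_ us]; exact: tree_frac_le.
have {}IH := IH (u :: dn) udn' hA'
  (leq_trans (leq_mul (leqnn B) (le_sum : _ < _.+1)%N) hW).
rewrite !vertices_cons; eapply runs_le.
  eapply runs_if_pair; first by run_steps.
  eapply runs_let.
    by eapply runs_call; [by [] | run_steps | exact: IH].
  eapply (@runs_ifpos _ _ _ _ _ _ (adj v u : nat)).
    eapply runs_call; [by [] | by run_steps |].
    rewrite -nth_adj_row.
    apply: (@runs_nth _ _ _ U); first by rewrite size_adj_row.
    exact: leq_trans (ltn_ord u) (leqW nW).
  - case vu : (adj v u) => // _; rewrite /= vu.
    have ur := uniq_catrev udn; have sr := set_catrev udn hA.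
    have [q0 q1] := sum_frac_bounds v (u :: dn) td tb.
    have q2 := sle _ _ udn' hA'.
    have := sle _ _ udn hA.
    have [p0 p1] := sum_frac_bounds v dn (u :: td) tb.
    move: p1 => /=; rewrite vu /= => p1 p2.
    have /andP[r0 r1] := tb u (catrev dn td).
    have r2 : ((tree_frac g h l u (catrev dn td)).1 <=
        2 ^ (B * \sum_(u <- u :: td | adj v u) tree_size l u (A :\ u)))%N.
      apply: leq_trans (tree_frac_le l u h_gt0 hB (proj2 (andP ur))) _.
      by rewrite sr leq_exp2l // leq_mul2l big_cons vu leq_addr orbT.
    have q3 : (2 ^ (B * \sum_(u <- td | adj v u) tree_size l u (A :\ u)) <=
        2 ^ (B * \sum_(u <- u :: td | adj v u) tree_size l u (A :\ u)))%N.
      by rewrite leq_exp2l // leq_mul2l le_sum orbT.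
    have n1 : (1 <= nv G)%N by exact: nv_gt0.
    eapply runs_le.
      eapply runs_let.
        eapply runs_call; [by [] | | apply: (htree u (catrev dn td)) => //].
          do 3 (eapply runs_pair; first by run_steps).
          by eapply runs_call; [by [] | run_steps | exact: runs_catrev].
        rewrite sr; apply: leq_trans hW; rewrite leq_mul2l big_cons vu.
        by rewrite leqW ?orbT // leq_addr.
      eapply runs_pair.
        eapply (@runs_add _ _ _ _ _ _ _ U).
        + eapply (@runs_mul _ _ _ _ _ _ _ U); [by run_steps|by run_steps|..].
            exact: fracW q1 (ltnW sz) (leq_trans q2 q3).
          by apply: (fracW _ _ 1%N _ n1 r2); rewrite mul1n.
        + eapply (@runs_mul _ _ _ _ _ _ _ U); [by run_steps|by run_steps|..].
            by apply: (fracW _ _ 1%N _ n1 r2); rewrite mul1n.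
          by apply: (fracW _ _ 1%N _ n1 (leq_trans q2 q3)); rewrite mul1n.
        + by apply: fracW p2; [apply: leq_trans p1; apply: leq_addr|].
        + by apply: fracW p2; [apply: leq_trans p1; apply: leq_addl|].
      eapply (@runs_mul _ _ _ _ _ _ _ U); [by run_steps|by run_steps|..].
        by apply: (fracW _ _ 1%N _ n1 (leq_trans q2 q3)); rewrite mul1n.
      by apply: (fracW _ _ 1%N _ n1 r2); rewrite mul1n.
    (* Both branches share one evar for their time. The conditional charges the subtree to
       neighbours only, so that the total stays a sum over [adj v u]. *)
    rewrite sr; instantiate (1 := (if adj v u then tree_size l u (A :\ u) * Q +
      (150 + 30 * U + 5 * (U * U)) else 1)%N).
    rewrite vu; have hs : ((size dn).+1 * 30 <= 30 * U)%N.
      by rewrite mulnC leq_mul2l (leq_trans szd) // leqW.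
    by move: hs; move: (_.+1 * 30)%N (tree_size _ _ _ * _)%N (U * U)%N; clear; lia.
  - case vu : (adj v u) => // _; rewrite /= vu.
    by eapply runs_le; [run_steps | ].
have nth_le : (u.+1 * (20 + U * U) <= U * (20 + U * U))%N.
  by rewrite leq_mul2r (leq_trans (ltn_ord u)) ?orbT //; lia.
have qU : (300 + U * (20 + U * U) + 30 * U + 5 * (U * U) <= q)%N.
  by rewrite /q; nia.
rewrite big_cons.
have -> : ((size (u :: td)).+1 * q = q + (size td).+1 * q)%N by rewrite mulSn.
move: nth_le qU; clearbody U Q q.
move: (\sum_(_ <- _ | _) _)%N (tree_size _ _ _) (u.+1 * _)%N (_.+1 * q)%N.
move: (U * (20 + U * U))%N => a; move: (U * U)%N => b.
by move=> c d e f; case: ifP => _; rewrite ?mulnDl;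
  move: (c * Q)%N (d * Q)%N; clear; lia.
Qed.

Lemma runs_tree (l : nat) (v : 'I_(nv G)) (s : seq 'I_(nv G)) :
  (l <= W)%N -> uniq s -> (B * tree_size l v [set x in s] <= W)%N ->
  runs orc P [:: tree_arg g h l v s] tree_body (vfrac (tree_frac g h l v s))
    (tree_size l v [set x in s] * Q).
Proof.
have U0 : (0 < U)%N by []; have UE : U = W.+1 by [].
elim: l v s => [|l IH] v s lW us hW.
  eapply runs_le; first by eapply runs_if_zero; run_steps.
  by rewrite /= mul1n /Q; nia.
have sA : [set x in s] =i [::] ++ s by move=> x; rewrite inE.
have tb u s' := @tree_frac_bounds G g h l u s' h_gt0.
have [q0 q1] := sum_frac_bounds v [::] s tb.
have /andP[r0 r1] := tree_frac_bounds g l.+1 v s h_gt0.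
have r2 := tree_frac_le l.+1 v h_gt0 hB us.
have hb x : (x <= (tree_frac g h l.+1 v s).1)%N -> (bits x <= U)%N.
  move=> hx; apply: bits_le_exp; apply: leq_trans hx (leq_trans r2 _).
  by rewrite leq_exp2l.
have hS : (\sum_(u <- s | adj v u) tree_size l u ([set x in s] :\ u)).+1 =
    tree_size l.+1 v [set x in s] by rewrite big_seq_set.
have q2 : ((sum_frac (tree_frac g h l) v [::] s).1 <= 2 ^ W)%N.
  apply: leq_trans q1 _.
  have := @sum_frac_le G (tree_frac g h l) (@tree_size G l) B v [set x in s] [::] s
    (fun u s' us' => tree_frac_le l u h_gt0 hB (proj2 (andP us'))) us sA.
  move/(leq_mul (leq_trans (size_uniq_ord us) nB)) => hle.
  apply: leq_trans hle _; rewrite -expnD -mulnS leq_exp2l //.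
  by rewrite hS.
have hle : (h <= 2 ^ W)%N.
  apply: leq_trans (leq_addr (g * nv G) h) (leq_trans hB _); rewrite leq_exp2l //.
  by apply: leq_trans hW; rewrite leq_pmulr // tree_size_gt0.
have gle : (g <= 2 ^ W)%N.
  apply: leq_trans (_ : (h + g * nv G <= _)%N).
    by apply: leq_trans (leq_addl _ _); rewrite leq_pmulr // nv_gt0.
  apply: (leq_trans hB); rewrite leq_exp2l //.
  by apply: leq_trans hW; rewrite leq_pmulr // tree_size_gt0.
eapply runs_le.
  eapply runs_if_pos; first by run_steps.
  eapply runs_let.
    eapply runs_call; [by [] | | apply: (@runs_sum l v [set x in s] [::] s)].
    - eapply runs_pair; first by run_steps.
      eapply runs_pair.
        eapply (@runs_pred _ _ _ _ _ U); first by run_steps.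
        exact: bits_le_small.
      eapply runs_pair; first by run_steps.
      by eapply runs_pair; run_steps.
    - by move=> u s' /andP[_ us'] hW'; apply: IH => //; apply: ltnW.
    - by [].
    - exact: sA.
    - by rewrite hS.
  eapply runs_let.
    eapply (@runs_mul _ _ _ _ _ _ _ U); [by run_steps|by run_steps|..].
      exact: bits_le_exp.
    apply: hb; apply: leq_trans r1; rewrite /=.
    by rewrite leq_pmull.
  eapply runs_pair; last by run_steps.
  eapply (@runs_add _ _ _ _ _ _ _ U); first by run_steps.
  - eapply (@runs_mul _ _ _ _ _ _ _ U); [by run_steps|by run_steps|..].
      exact: bits_le_exp.
    exact: bits_le_exp.
  - by apply: hb; apply: leq_addr.
  - by apply: hb; apply: leq_addl.
rewrite -hS; set S := \sum_(_ <- _ | _) _.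
have sz : ((size s).+1 * q <= U * q)%N.
  by rewrite leq_mul2r ltnS (leq_trans (size_uniq_ord us)) ?orbT.
have QU : (100 + 4 * (U * U) + U * q <= Q)%N by rewrite /q /Q; nia.
move: sz QU; rewrite !mulSn; clearbody U Q q S.
by move: (size s * q)%N (S * Q)%N (U * q)%N (U * U)%N; clear; lia.
Qed.

Lemma runs_outer (l S : nat) (s : seq 'I_(nv G)) :
  (l <= W)%N -> uniq s ->
  (forall (v : 'I_(nv G)) (A : {set 'I_(nv G)}),
     v \notin A -> (tree_size l v A <= S)%N) ->
  (B * S * size s <= W)%N ->
  runs orc P [:: VPair (VPair (VInt g) (VInt h)) (VPair (VInt l) (vertices s))]
    outer_body (vfrac (outer_frac g h l s))
    ((size s).+1 * (S * Q + 100 + 2 * (U * U))).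
Proof.
move=> lW us hS hW; elim: s us hW => [|v s IH] us hW.
  by eapply runs_le; [eapply runs_if_int; run_steps | lia].
have [vs us'] := andP us.
have /andP[z0 z1] := outer_frac_bounds g l s h_gt0.
have z2 := outer_frac_le h_gt0 hB us' hS.
have hW' : (B * S * size s <= W)%N.
  by apply: leq_trans hW; rewrite leq_mul2l leqnSn orbT.
have /andP[r0 r1] := tree_frac_bounds g l v s h_gt0.
have ts : (tree_size l v [set x in s] <= S)%N by apply: hS; rewrite inE.
have tW : (B * tree_size l v [set x in s] <= W)%N.
  apply: leq_trans hW; rewrite /= mulnS; apply: leq_trans (leq_addr _ _).
  by rewrite leq_mul2l ts orbT.
have r2 := tree_frac_le l v h_gt0 hB us'.
have e2 : (2 ^ (B * S * size s) <= 2 ^ W)%N by rewrite leq_exp2l.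
have e3 : (2 ^ (B * tree_size l v [set x in s]) <= 2 ^ W)%N by rewrite leq_exp2l.
rewrite vertices_cons; eapply runs_le.
  eapply runs_if_pair; first by run_steps.
  eapply runs_let.
    by eapply runs_call; [by [] | run_steps | apply: IH].
  eapply runs_let.
    by eapply runs_call; [by [] | run_steps | apply: runs_tree].
  eapply runs_pair.
    eapply (@runs_mul _ _ _ _ _ _ _ U); [by run_steps|by run_steps|..].
      exact: bits_le_exp (leq_trans z2 e2).
    exact: bits_le_exp (leq_trans r2 e3).
  eapply (@runs_mul _ _ _ _ _ _ _ U); [by run_steps|by run_steps|..].
    exact: bits_le_exp (leq_trans z1 (leq_trans z2 e2)).
  exact: bits_le_exp (leq_trans r1 (leq_trans r2 e3)).
have : (tree_size l v [set x in s] * Q <= S * Q)%N by rewrite leq_mul2r ts orbT.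
by rewrite [size (v :: s)]/= [in X in _ -> (_ <= X)%N]mulSn; lia.
Qed.

End Runs.

(** * Running time and accuracy *)

(** [W] is the bit length of the final product given by [outer_frac_le]. There are [nv G] trees of
    at most [S] nodes, each node costs order W^4, and both [nv G] and [S] are at most [W]: hence the
    sixth power. *)
Lemma runs_main (orc : oracle_name -> nat -> int) (L0 L1 : nat) (G : sgraph)
    (g l j B S : nat) :
  let W := (B * S * nv G)%N in
  (0 < L1)%N -> l = (L0 + L1 * ((trunc_log 2 (nv G)).+1 + j))%N ->
  orc Activity l = g -> (forall i, (i < j)%N -> orc Accuracy i = 0) ->
  orc Accuracy j = 1 -> (2 ^ l + g * nv G <= 2 ^ B)%N ->
  (nv G <= B)%N -> (l <= B)%N -> (0 < S)%N ->
  (forall (v : 'I_(nv G)) (A : {set 'I_(nv G)}),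
     v \notin A -> (tree_size l v A <= S)%N) ->
  runs orc (approx_program L0 L1) [:: graph_code G] (Call 0 (Var 0))
    (vfrac (outer_frac g (2 ^ l) l (enum 'I_(nv G)))) (3000 * W.+1 ^ 6).
Proof.
move=> W L1_gt0 lE gE j0 j1 hB nB lB S0 hS.
have n0 := nv_gt0 G.
have BW : (B <= W)%N by rewrite /W -mulnA leq_pmulr // muln_gt0 S0.
have SW : (S <= W)%N.
  by rewrite /W mulnAC leq_pmull // muln_gt0 n0 andbT; apply: leq_trans nB.
have lW := leq_trans lB BW; have nW := leq_trans nB BW.
have h0 : (0 < 2 ^ l)%N by rewrite expn_gt0.
have n2B : (nv G <= 2 ^ B)%N by apply: leq_trans nB (ltnW (ltn_expl _ _)).
have logW : ((trunc_log 2 (nv G)).+1 + j <= l)%N.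
  by rewrite lE; apply: leq_trans (leq_addl _ _); rewrite leq_pmull.
have L0W : (L0 <= l)%N by rewrite lE leq_addr.
have L1W : (L1 <= l)%N.
  by rewrite lE; apply: leq_trans (leq_addl _ _); rewrite leq_pmulr.
have mW : (L1 * ((trunc_log 2 (nv G)).+1 + j) <= l)%N by rewrite lE leq_addl.
have gW : (g <= 2 ^ W)%N.
  apply: leq_trans (_ : (g * nv G <= _)%N); first by rewrite leq_pmulr.
  apply: leq_trans (leq_addl _ _) (leq_trans hB _).
  by rewrite leq_exp2l.
have sz : size (enum 'I_(nv G)) = nv G by rewrite size_enum_ord.
have bsm x : (x <= l)%N -> (bits x <= W.+1)%N.
  by move=> xl; apply: bits_le_small; apply: leq_trans xl lW.
eapply runs_le.
  eapply runs_call; [by [] | by run_steps |].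
  eapply (@runs_let _ _ _ _ _ (VInt l)).
    rewrite lE.
    eapply (@runs_add _ _ _ _ _ _ _ W.+1).
    - exact: runs_const (bsm _ L0W).
    - eapply (@runs_mul _ _ _ _ _ _ _ W.+1).
      + exact: runs_const (bsm _ L1W).
      + eapply (@runs_add _ _ _ _ _ _ _ W.+1).
        * by eapply runs_call; [by [] | run_steps | exact: (@runs_log _ _ _ W.+1)].
        * eapply runs_call; [by [] | by run_steps |].
          by apply: (@runs_prec _ _ _ W.+1 j 0) => //; lia.
        * by apply: bsm; lia.
        * by apply: bsm; lia.
      + exact: bsm.
      + exact: bsm.
    - exact: bsm.
    - exact: bsm.
  eapply runs_call; [by [] | |
    apply: (@runs_outer orc L0 L1 G g (2 ^ l) B W h0 hB n2B nW l S)] => //.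
  - eapply runs_pair.
      eapply runs_pair.
        rewrite -gE; eapply (@runs_query _ _ _ _ _ _ W.+1); first by run_steps.
        by rewrite gE; apply: bits_le_exp.
      eapply runs_call; [by [] | by run_steps |].
      by apply: (@runs_pow2 _ _ _ W.+1).
    eapply runs_pair; first by run_steps.
    eapply runs_call; [by [] | |].
      by run_steps.
    apply: (@runs_rows _ _ _ G W.+1 0 (enum 'I_(nv G))).
      by rewrite val_enum_ord sz.
    by rewrite sz.
  - exact: enum_uniq.
  - by rewrite sz.
rewrite sz subn0; move: (trunc_log 2 (nv G)) logW => t logW.
have {logW}jW : (j <= W)%N by lia.
have UU : (0 < W.+1 * W.+1)%N by [].
have a1 : (nv G * (30 + 3 * (W.+1 * W.+1)) <= W.+1 * (33 * (W.+1 * W.+1)))%N.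
  by apply: leq_mul; [apply: leqW | clear -UU; lia].
have a2 : (j.+1 * (30 + 2 * (W.+1 * W.+1)) <= W.+1 * (33 * (W.+1 * W.+1)))%N.
  by apply: leq_mul => //; clear -UU; lia.
have a3 : (l.+1 * (30 + 2 * (W.+1 * W.+1)) <= W.+1 * (33 * (W.+1 * W.+1)))%N.
  by apply: leq_mul => //; clear -UU; lia.
have a4 : ((nv G).+1 * (30 + W.+1 * W.+1) <= W.+1 * (33 * (W.+1 * W.+1)))%N.
  by apply: leq_mul => //; clear -UU; lia.
have a5 : ((nv G).+1 * (S * (900 * (W.+1 * W.+1 * W.+1 * W.+1)) + 100 +
      2 * (W.+1 * W.+1)) <=
    W.+1 * (W.+1 * (900 * (W.+1 * W.+1 * W.+1 * W.+1)) + 102 * (W.+1 * W.+1)))%N.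
  apply: leq_mul => //.
  rewrite -addnA leq_add //; last by clear -UU; lia.
  by rewrite leq_mul2r leqW ?orbT.
have lW' : (l <= W.+1)%N by apply: leqW.
move: a1 a2 a3 a4 a5 lW'; move: (nv G * _)%N (j.+1 * _)%N (l.+1 * _)%N.
move: ((nv G).+1 * (30 + W.+1 * W.+1))%N => x1; move: ((nv G).+1 * _)%N => x2.
have : (0 < W.+1)%N by [].
move: (W.+1) => U; rewrite !expnS expn0 muln1; clear => U0 x3 x4 x5 a1 a2 a3 a4 a5 lU.
by nia.
Qed.

(** With [q] the root in the definition of the distance, a distance of at most 1 gives 2 x - 1 <= 2
    y - 1 + q. Then q^2 <= (2 y - 1) (2 y - 1 + q), which forces q <= 2 (2 y - 1) <= 4 y. *)
Lemma ratio_dist_rel (R : rcfType) (x y : R) :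
  1 <= x -> 1 <= y -> ratio_dist x y <= 1 ->
  `|x - y| <= 2 * ratio_dist x y * y.
Proof.
move=> x1 y1; rewrite /ratio_dist; set q := Num.sqrt _.
have q0 : 0 < q by rewrite sqrtr_gt0; nra.
have qq : q ^+ 2 = (2 * x - 1) * (2 * y - 1) by rewrite sqr_sqrtr; nra.
have := normr_ge0 (x - y); move: (ler_norm (x - y)); set d := `|_| => dx d0.
rewrite ler_pdivrMr // mul1r => dq.
have qy : q <= 2 * (2 * y - 1) by nra.
have -> : 2 * (2 * d / q) * y = d * (4 * y / q) by field; rewrite gt_eqF.
by rewrite ler_peMr // ler_pdivlMr //; nra.
Qed.

Lemma outer_frac_approx (R : realType) (G : sgraph) (g h l : nat) (q eta : R)
    (s : seq 'I_(nv G)) :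
  (0 < h)%N -> q = g%:R / h%:R -> 0 <= eta <= 1 -> uniq s ->
  (forall (v : 'I_(nv G)) (A : {set 'I_(nv G)}), v \notin A ->
     `|trunc_ratio q l v A - vertex_ratio q v A| <=
     eta * vertex_ratio q v A) ->
  (1 - eta) ^+ size s * sub_partition q [set x in s] <=
  (outer_frac g h l s).1%:R / (outer_frac g h l s).2%:R <=
  (1 + eta) ^+ size s * sub_partition q [set x in s].
Proof.
move=> h0 qE /andP[e0 e1] us herr.
have g0 : 0 <= q by rewrite qE divr_ge0.
elim: s us => [|v s IH] /= => [_|/andP[vs us]].
  have -> : [set x : 'I_(nv G) in [::]] = set0 by apply/setP => x; rewrite !inE.
  by rewrite sub_partition0 divr1 !mul1r lexx.
have /andP[lo hi] := IH us; set A := [set x in s] in lo hi *.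
have vA : v \notin A by rewrite inE.
have -> : [set x in v :: s] = v |: A by apply/setP => x; rewrite !inE.
have Z1 := sub_partition_ge1 A g0.
have Zr : sub_partition q (v |: A) =
    vertex_ratio q v A * sub_partition q A.
  by rewrite /vertex_ratio divfK // gt_eqF // (lt_le_trans ltr01).
have := herr v A vA; rewrite ler_norml.
have -> : trunc_ratio q l v A =
    (tree_frac g h l v s).1%:R / (tree_frac g h l v s).2%:R.
  by rewrite qE tree_frac_val.
rewrite Zr !natrM.
have := vertex_ratio_ge1 g0 vA.
have /andP[z0 _] := outer_frac_bounds g l s h0.
have /andP[r0 _] := tree_frac_bounds g l v s h0.
move: lo hi Z1; move: (vertex_ratio _ _ _) (sub_partition _ A) => r Z lo hi Z1 r1.
set t := _ / (tree_frac _ _ _ _ _).2%:R => /andP[t1 t2].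
have -> : (outer_frac g h l s).1%:R * (tree_frac g h l v s).1%:R /
    ((outer_frac g h l s).2%:R * (tree_frac g h l v s).2%:R) =
    t * ((outer_frac g h l s).1%:R / (outer_frac g h l s).2%:R) :> R.
  by rewrite /t; field; rewrite !pnatr_eq0 -!lt0n z0 r0.
move: lo hi; set z := _ / (outer_frac _ _ _ _).2%:R => lo hi.
have z_ge0 : 0 <= z by rewrite /z divr_ge0.
rewrite !exprS; apply/andP; split.
  have -> : (1 - eta) * (1 - eta) ^+ size s * (r * Z) =
    ((1 - eta) * r) * ((1 - eta) ^+ size s * Z) by ring.
  apply: ler_pM => //; last lra.
    by rewrite mulr_ge0 ?subr_ge0 //; lra.
  by rewrite mulr_ge0 ?exprn_ge0 ?subr_ge0 //; lra.
have -> : (1 + eta) * (1 + eta) ^+ size s * (r * Z) =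
    ((1 + eta) * r) * ((1 + eta) ^+ size s * Z) by ring.
by apply: ler_pM => //; [rewrite /t divr_ge0 | lra].
Qed.

Lemma matching_card (G : sgraph) (M : {set {set 'I_(nv G)}}) :
  matching M -> (#|M| <= nv G)%N.
Proof.
move=> mM; have [_ tM] := andP mM; have M0 := matching_nonempty mM.
rewrite -[X in (_ <= X)%N](card_ord (nv G)); apply: leq_trans (max_card [in cover M]).
have /eqP-> : #|cover M| == (\sum_(A in M) #|A|)%N.
  by rewrite (leq_card_cover M).2.
rewrite -sum1_card; apply: leq_sum => A AM; rewrite card_gt0.
by apply: contraNneq M0 => <-.
Qed.

(** A matching has at most [nv G] edges, so lowering the activity by a factor 1 - eta costs each
    weight at most that factor to the power [nv G]. *)
Lemma partition_function_perturb (R : realType) (G : sgraph) (g g' eta : R) :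
  0 <= g' <= g -> 0 <= eta <= 1 -> (1 - eta) * g <= g' ->
  (1 - eta) ^+ nv G * partition_function G g <= partition_function G g' /\
  partition_function G g' <= partition_function G g.
Proof.
move=> /andP[g0 gg] /andP[e0 e1] h; split.
  rewrite /partition_function mulr_sumr; apply: ler_sum => M mM.
  apply: (@le_trans _ _ (((1 - eta) * g) ^+ #|M|)).
    rewrite exprMn ler_wpM2r ?exprn_ge0 //; first lra.
    by apply: ler_wiXn2l; rewrite ?matching_card //; lra.
  by apply: lerXn2r; rewrite ?nnegrE // mulr_ge0; lra.
by apply: ler_sum => M _; apply: lerXn2r; rewrite ?nnegrE //; lra.
Qed.

(** Gives the point where [prec_body] stops, and the two-sided estimate by which 2^j stands for 1 /
    eps. *)
Lemma first_digit (R : realType) (eps : R) : 0 < eps <= 1 ->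
  exists j : nat, [/\ forall i, (i < j)%N -> Num.floor (eps * 2 ^+ i) = 0,
    Num.floor (eps * 2 ^+ j) = 1 & 1 <= eps * 2 ^+ j < 2].
Proof.
move=> /andP[e0 e1].
have ex : exists k, 1 <= eps * 2 ^+ k.
  exists (Num.bound eps^-1); rewrite mulrC -ler_pdivrMr // mul1r ltW //.
  exact: upper_nthrootP.
case: (ex_minnP ex) => j hj hmin; exists j.
have h2 : eps * 2 ^+ j < 2.
  case: j hj hmin => [|j] hj hmin; first by rewrite expr0 mulr1; lra.
  have : ~~ (1 <= eps * 2 ^+ j) by apply/negP => /hmin; rewrite ltnn.
  by rewrite -ltNge exprS; lra.
split; rewrite ?hj ?h2 //.
- move=> i ij; apply: floor_def; rewrite add0r mulr_ge0 ?exprn_ge0 ?ltW //=.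
  by rewrite ltNge; apply/negP => /hmin; rewrite leqNgt ij.
- by apply: floor_def; rewrite hj h2.
Qed.

(** Writing [Delta] as a power of 2 exchanges base and exponent: a depth logarithmic in n / eps
    becomes a power of n / eps. *)
Lemma expr_le_powR (R : realType) (Delta y : R) (k : nat) :
  1 <= Delta -> 2 ^+ k <= y -> Delta ^+ k <= y `^ (ln Delta / ln 2).
Proof.
move=> D1 ky; have l2 : 0 < ln (2 : R) by rewrite ln_gt0 // ltr1n.
have D0 : 0 < Delta by apply: lt_le_trans D1.
have DE : Delta = 2 `^ (ln Delta / ln 2).
  by rewrite /powR pnatr_eq0 /= divfK ?gt_eqF // lnK // posrE.
have t0 : 0 <= ln Delta / ln 2 by exact: divr_ge0 (ln_ge0 D1) (ltW l2).
rewrite {1}DE -powR_mulrn ?powR_ge0 // powRAC powR_mulrn; last lra.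
have p0 : 0 <= 2 ^+ k :> R by rewrite exprn_ge0.
by apply: ge0_ler_powR; rewrite ?nnegrE // (le_trans p0).
Qed.

Lemma ln_le_trunc_log (R : realType) (n : nat) : (0 < n)%N ->
  ln (n%:R : R) <= (trunc_log 2 n).+1%:R.
Proof.
move=> n0; have l2 : ln (2 : R) <= 1.
  by rewrite -[X in ln X]/(1 + 1); apply: le_ln1Dx; lra.
apply: (@le_trans _ _ (ln (2 ^+ (trunc_log 2 n).+1))).
  rewrite ler_ln ?posrE ?ltr0n ?exprn_gt0 //.
  by rewrite -natrX ler_nat ltnW // trunc_log_ltn.
by rewrite lnXn // -[ln 2 *+ _]mulr_natr ler_piMl.
Qed.

(** The condition on [m] makes the contraction factor at most 1 / (2 Delta), so the walks weigh c /
    2^l in total. The condition on [l] then yields a distance of at most eps / (8 n), with n^2 / eps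
    enlarged to (n / eps)^2, and [ratio_dist_rel] doubles this. *)
Lemma trunc_ratio_error (R : realType) (G : sgraph) (g gamma Delta c eps : R)
    (m l : nat) (v : 'I_(nv G)) (A : {set 'I_(nv G)}) :
  0 < g <= gamma -> (1 < m)%N -> 8 * (gamma * Delta) <= m%:R ^+ 2 - 1 ->
  0 < Delta -> 0 < c -> 0 < eps <= 1 -> v \notin A ->
  (num_walks l v A)%:R <= c * Delta ^+ l ->
  c * (8 * (1 + 2 * gamma) * ((nv G)%:R / eps) ^+ 2) ^+ m.+1 <= 2 ^+ l ->
  `|trunc_ratio g l v A - vertex_ratio g v A| <=
  eps / (4 * (nv G)%:R) * vertex_ratio g v A.
Proof.
move=> /andP[g0 gg] m1 hm D0 c0 /andP[e0 e1] vA hN hl.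
set n : R := (nv G)%:R; have n1 : 1 <= n by rewrite ler1n nv_gt0.
have M2 : 2 <= m%:R :> R by rewrite ler_nat.
have M0 : 0 < m%:R ^+ 2 - 1 :> R by nra.
have gm0 : 0 < gamma by apply: lt_le_trans gg.
have k1 : 4 * g / (m%:R ^+ 2 - 1) <= (2 * Delta)^-1.
  rewrite ler_pdivrMr // [leRHS]mulrC ler_pdivlMr ?mulr_gt0 //.
  by apply: le_trans hm; have := ler_wpM2r (ltW D0) gg; lra.
have k0 : 0 <= 4 * g / (m%:R ^+ 2 - 1) by rewrite divr_ge0 ?ltW // mulr_gt0 //; lra.
have y1 := vertex_ratio_ge1 (ltW g0) vA.
have x1 := @trunc_ratio_ge1 R G g l v A (ltW g0).
set d := ratio_dist (trunc_ratio g l v A) (vertex_ratio g v A).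
have hd : d <= eps / (8 * n).
  rewrite -(@ler_pXn2r _ m.+1) ?nnegrE ?ratio_dist_ge0 //; last first.
    by rewrite divr_ge0 ?mulr_ge0 ?ltW //; lra.
  apply: le_trans (trunc_ratio_decay l g0 m1 vA) _.
  apply: (@le_trans _ _ ((2 * Delta)^-1 ^+ l * (c * Delta ^+ l) *
                         ((1 + 2 * gamma) * n) ^+ m.+1)).
    apply: ler_pM.
    - by rewrite mulr_ge0 ?exprn_ge0.
    - by rewrite exprn_ge0 // addr_ge0 ?mulr_ge0 //; lra.
    - by apply: ler_pM; rewrite ?exprn_ge0 // lerXn2r ?nnegrE // invr_ge0; lra.
    - apply: lerXn2r; rewrite ?nnegrE.
      + by rewrite addr_ge0 ?mulr_ge0 //; lra.
      + by rewrite mulr_ge0; lra.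
      + have := ler_wpM2r (le_trans ler01 n1) gg; rewrite -/n; lra.
  have -> : (2 * Delta)^-1 ^+ l * (c * Delta ^+ l) = c / 2 ^+ l.
    rewrite exprVn exprMn; field.
    by rewrite !expf_neq0 // ?pnatr_eq0 // gt_eqF.
  rewrite mulrAC ler_pdivrMr ?exprn_gt0 //.
  apply: le_trans (ler_wpM2l _ hl); last first.
    by rewrite exprn_ge0 // divr_ge0 ?mulr_ge0 ?ltW //; lra.
  rewrite [leRHS]mulrCA ler_wpM2l ?(ltW c0) // -exprMn lerXn2r ?nnegrE //.
  - by rewrite mulr_ge0; lra.
  - by rewrite !mulr_ge0 ?invr_ge0 ?exprn_ge0 ?mulr_ge0 ?invr_ge0 //; lra.
  rewrite -/n.
  have -> : eps / (8 * n) * (8 * (1 + 2 * gamma) * (n / eps) ^+ 2) =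
     (1 + 2 * gamma) * (n / eps) by field; rewrite !gt_eqF //; lra.
  rewrite ler_wpM2l //; first lra.
  by rewrite ler_pdivlMr // ler_piMr //; lra.
have d1 : d <= 1.
  apply: le_trans hd _; rewrite ler_pdivrMr; lra.
apply: le_trans (ratio_dist_rel x1 y1 d1) _; rewrite -/d.
rewrite ler_wpM2r //; first lra.
have -> : eps / (4 * n) = 2 * (eps / (8 * n)) by field; rewrite gt_eqF //; lra.
by rewrite ler_wpM2l.
Qed.

(** From (1 + x) (1 - x) <= 1 and Bernoulli for 1 - x, the power is at most 1 / (1 - n x). *)
Lemma expr1D_le (R : realFieldType) (n : nat) (x : R) :
  0 <= x -> n%:R * x <= 2^-1 -> (1 + x) ^+ n <= 1 + 2 * (n%:R * x).
Proof.
move=> x0 h; case: n h => [|n] h; first by rewrite expr0 mul0r; lra.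
have n1 : 1 <= n.+1%:R :> R by rewrite ler1n.
have xh : x <= 2^-1 by nra.
have := @bernoulli_ge R n.+1 (- x) ltac:(lra); rewrite mulrN => hb.
set y := n.+1%:R * x in h hb *.
have y0 : 0 <= y by rewrite mulr_ge0.
have p0 : 0 <= (1 + x) ^+ n.+1 by rewrite exprn_ge0 //; lra.
have : (1 + x) ^+ n.+1 * (1 - x) ^+ n.+1 <= 1.
  by rewrite -exprMn exprn_ile1; nra.
by move: ((1 + x) ^+ n.+1) ((1 - x) ^+ n.+1) p0 hb => a b; nra.
Qed.

(** The lower side pays twice, for rounding the activity and for truncation, each time a factor 1 -
    eps / 4. The upper side pays only for truncation, because the activity is rounded down. *)
Lemma approximates_combine (R : realType) (G : sgraph) (gamma q eps Zhat : R) :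
  0 < gamma -> 0 <= q <= gamma -> 0 < eps <= 1 ->
  (1 - eps / (4 * (nv G)%:R)) * gamma <= q ->
  (1 - eps / (4 * (nv G)%:R)) ^+ nv G * partition_function G q <= Zhat <=
  (1 + eps / (4 * (nv G)%:R)) ^+ nv G * partition_function G q ->
  approximates eps (partition_function G gamma) Zhat.
Proof.
move=> gm0 hq /andP[e0 e1] hg /andP[lo hi].
have n1 : 1 <= (nv G)%:R :> R by rewrite ler1n nv_gt0.
set eta := eps / _ in hg lo hi *.
have ne : (nv G)%:R * eta = eps / 4 by rewrite /eta; field; rewrite gt_eqF //; lra.
have eta0 : 0 <= eta by rewrite divr_ge0; lra.
have eta1 : eta <= 1 by nra.
have [P1 P2] := @partition_function_perturb R G gamma q eta hq ltac:(lra) hg.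
have Z0 : 0 <= partition_function G gamma.
  by rewrite sumr_ge0 // => M _; rewrite exprn_ge0 // ltW.
have Z0' : 0 <= partition_function G q.
  by rewrite sumr_ge0 // => M _; rewrite exprn_ge0 //; case/andP: hq.
have B1 := @bernoulli_ge R (nv G) (- eta) ltac:(lra); rewrite mulrN ne in B1.
have B2 := @expr1D_le R (nv G) eta eta0 ltac:(lra); rewrite ne in B2.
apply/andP; split.
  apply: le_trans lo; apply: (@le_trans _ _ ((1 - eps / 4) * partition_function G q)).
    move: (partition_function G q) (partition_function G gamma)
      P1 Z0 {P2 Z0' hi} => z Z P1 Z0.
    have : (1 - eps / 4) * Z <= z by apply: le_trans P1; rewrite ler_wpM2r.
    nra.
  by rewrite ler_wpM2r.
apply: le_trans hi _.
apply: (@le_trans _ _ ((1 + eps) * partition_function G q)).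
  by rewrite ler_wpM2r //; lra.
by rewrite ler_wpM2l //; lra.
Qed.

(** * Choice of the constants and the final bounds *)

Definition log_factor (R : realType) (a : R) : nat := (2 + Num.bound `|a|)%N.

(** The total exponent is 6, the degree in [runs_main], times the exponent in [time_bound]. The
    first summand covers m + 1 <= 3 s + 4 <= (3 + 4 / sqrt delta) s for s = sqrt (gamma Delta); the
    second covers the remaining 12 through s ln Delta >= sqrt delta ln (1 + delta). *)
Definition exponent_const (R : realType) (a delta : R) : R :=
  6 * (log_factor a)%:R * (3 + 4 / Num.sqrt delta) / ln 2 +
  12 / (Num.sqrt delta * ln (1 + delta)).

Lemma exponent_const_gt0 (R : realType) (a delta : R) :
  0 < delta -> 0 < exponent_const a delta.
Proof.
move=> d0; have l2 : 0 < ln (2 : R) by rewrite ln_gt0 // ltr1n.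
have ld : 0 < ln (1 + delta) by rewrite ln_gt0 //; lra.
have sd : 0 < Num.sqrt delta by rewrite sqrtr_gt0.
rewrite /exponent_const addr_gt0 // divr_gt0 ?mulr_gt0 ?ltr0n //.
by rewrite addr_gt0 // divr_gt0.
Qed.

Lemma exponent_le (R : realType) (a delta Delta s : R) (m : nat) :
  0 < delta -> 1 + delta <= Delta -> Num.sqrt delta <= s ->
  m.+1%:R <= 3 * s + 4 ->
  (2 + ln Delta / ln 2 * (m.+1 * log_factor a)%:R) * 6 <=
  exponent_const a delta * (s * ln Delta).
Proof.
move=> d0 hD hs hm; have l2 : 0 < ln (2 : R) by rewrite ln_gt0 // ltr1n.
have ld : 0 < ln (1 + delta) by rewrite ln_gt0 //; lra.
have sd : 0 < Num.sqrt delta by rewrite sqrtr_gt0.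
have lD : ln (1 + delta) <= ln Delta by rewrite ler_ln ?posrE; lra.
have lD0 : 0 <= ln Delta by lra.
set r := Num.sqrt delta in hs sd *; pose f : R := (log_factor a)%:R.
have f0 : 0 <= f by [].
have h12 : 12 <= 12 / (r * ln (1 + delta)) * (s * ln Delta).
  rewrite mulrAC ler_pdivlMr ?mulr_gt0 // ler_wpM2l //.
  by apply: ler_pM => //; apply: ltW.
have hm' : m.+1%:R <= s * (3 + 4 / r).
  apply: le_trans hm _; have : 4 <= 4 / r * s.
    by rewrite mulrAC ler_pdivlMr // ler_wpM2l.
  lra.
have hmain : ln Delta / ln 2 * (m.+1%:R * f) * 6 <=
    6 * f * (3 + 4 / r) / ln 2 * (s * ln Delta).
  have -> : 6 * f * (3 + 4 / r) / ln 2 * (s * ln Delta) =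
    6 * f * (ln Delta / ln 2) * (s * (3 + 4 / r)) by ring.
  have -> : ln Delta / ln 2 * (m.+1%:R * f) * 6 =
    6 * f * (ln Delta / ln 2) * m.+1%:R by ring.
  by rewrite ler_wpM2l // !mulr_ge0 // invr_ge0 ltW.
by rewrite natrM /exponent_const -/r -/f; lra.
Qed.

(** The factors [l + Gam + n] and [n] are linear in n / eps and give the 2 in the exponent. The
    factor [S] is of order Delta^l, and 2^(t+1+j) <= 4 n / eps turns it into a power of n / eps. *)
Lemma time_bound (R : realType) (n S Gam L0 L1 t j l : nat) (c Delta eps : R) :
  (0 < n)%N -> (2 ^ t <= n)%N -> 0 < eps <= 1 -> eps * 2 ^+ j < 2 ->
  1 <= Delta -> 1 <= c ->
  l = (L0 + L1 * (t.+1 + j))%N ->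
  S%:R <= 2 * c * Delta ^+ l ->
  ((l + Gam + n) * S * n).+1%:R <= 1 + (L0 + 3 * L1 + Gam + 1)%:R * (2 * c) *
      (Delta ^+ L0 * 4 `^ (ln Delta / ln 2 * L1%:R)) *
      (n%:R / eps) `^ (2 + ln Delta / ln 2 * L1%:R).
Proof.
move=> n0 tn /andP[e0 e1] ej D1 c1 lE hS.
set x := n%:R / eps.
have n1 : 1 <= n%:R :> R by rewrite ler1n.
have nx : n%:R <= x by rewrite /x ler_pdivlMr // ler_piMr //; lra.
have x1 : 1 <= x by lra.
have ex : eps^-1 <= x by rewrite /x mulrC ler_peMr // invr_ge0 ltW.
have p2j : 2 ^+ j <= 2 * x.
  apply: (@le_trans _ _ (2 / eps)); first by rewrite ler_pdivlMr // mulrC ltW.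
  by rewrite ler_wpM2l.
have jx : j%:R <= 2 * x.
  by apply: le_trans p2j; rewrite -natrX ler_nat ltnW // ltn_expl.
have tx : t.+1%:R <= x.
  by apply: le_trans nx; rewrite ler_nat; apply: leq_trans tn; apply: ltn_expl.
have k4 : 2 ^+ (t.+1 + j) <= 4 * x.
  rewrite exprD exprS.
  have -> : 4 * x = 2 * n%:R * (2 / eps) by rewrite /x; ring.
  apply: ler_pM; rewrite ?mulr_ge0 ?exprn_ge0 //.
    by rewrite ler_wpM2l // -natrX ler_nat.
  by rewrite ler_pdivlMr // mulrC ltW.
set th := ln Delta / ln 2.
have Dk : Delta ^+ (t.+1 + j) <= (4 * x) `^ th by apply: expr_le_powR.
have Dl : Delta ^+ l <= Delta ^+ L0 * (4 `^ (th * L1%:R) * x `^ (th * L1%:R)).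
  rewrite lE exprD ler_wpM2l ?exprn_ge0 //; first lra.
  rewrite mulnC exprM -powRM; [|lra|lra].
  rewrite powRrM powR_mulrn ?powR_ge0 // lerXn2r ?nnegrE ?powR_ge0 //.
  by rewrite exprn_ge0 //; lra.
have Bx : (l + Gam + n)%:R <= (L0 + 3 * L1 + Gam + 1)%:R * x.
  rewrite lE !natrD !natrM !natrD.
  have := ler_wpM2l (ler0n R L1) (lerD tx jx).
  have := ler_wpM2l (ler0n R L0) x1; have := ler_wpM2l (ler0n R Gam) x1.
  lra.
rewrite -natr1 addrC lerD2l !natrM.
have -> : x `^ (2 + th * L1%:R) = x ^+ 2 * x `^ (th * L1%:R).
  have x0 : x != 0 by rewrite gt_eqF //; lra.
  by rewrite powRD ?x0 ?implybT // powR_mulrn //; lra.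
set D4 := 4 `^ _ in Dl *; set y := x `^ _ in Dl *.
have -> : (L0 + 3 * L1 + Gam + 1)%:R * (2 * c) * (Delta ^+ L0 * D4) * (x ^+ 2 * y) =
  ((L0 + 3 * L1 + Gam + 1)%:R * x) * (2 * c * (Delta ^+ L0 * (D4 * y))) * x by ring.
apply: ler_pM; rewrite ?mulr_ge0 //.
apply: ler_pM => //; apply: le_trans hS _.
by rewrite ler_wpM2l //; lra.
Qed.

Lemma scheme_exists (R : realType) (a delta Delta gamma c : R)
    (F : sgraph -> Prop) :
  0 < delta -> 1 + delta <= Delta -> 0 < gamma -> delta <= gamma * Delta ->
  1 <= c -> connective_bound a c Delta F ->
  exists (P : program) (K : R), 0 <= K /\
    approx_scheme F gamma P (fun n eps =>
      K * (n%:R / eps) `^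
        (exponent_const a delta * (Num.sqrt (gamma * Delta) * ln Delta))).
Proof.
move=> d0 hD gm0 hgD c1 hF.
have D1 : 1 <= Delta by lra. have D0 : 0 < Delta by lra.
set s := Num.sqrt (gamma * Delta).
have s0 : 0 <= s by rewrite sqrtr_ge0.
have ss : s ^+ 2 = gamma * Delta by rewrite sqr_sqrtr // mulr_ge0 // ltW.
have sd : Num.sqrt delta <= s by rewrite ler_sqrt //; lra.
(* This exceeds 3 s + 1, so m^2 - 1 is at least 9 s^2, while [m] stays linear in [s]. *)
set m := (Num.truncn (3 * s)).+2.
have /andP[tr1 tr2] : (Num.truncn (3 * s))%:R <= 3 * s < (Num.truncn (3 * s)).+1%:R.
  by apply: truncn_itv; rewrite mulr_ge0.
have m1 : (1 < m)%N by [].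
have mE : m%:R = (Num.truncn (3 * s))%:R + 2 :> R by rewrite /m -addn2 natrD.
have hm : 8 * (gamma * Delta) <= m%:R ^+ 2 - 1.
  by rewrite -ss mE; move: tr2; rewrite -natr1; nra.
have hm4 : m.+1%:R <= 3 * s + 4 by rewrite -natr1 mE; lra.
(* In [log_factor a], the 2 yields the factor (n / eps)^(2 (m + 1)) required of 2^l, and the bound
   on [a] yields a ln n <= l. [L0] absorbs the constant of that requirement and, with 4 / gamma, the
   rounding of the activity. *)
pose L1 := (m.+1 * log_factor a)%N.
pose L0 := Num.bound (c * (8 * (1 + 2 * gamma)) ^+ m.+1 + 4 / gamma).
have L0b : c * (8 * (1 + 2 * gamma)) ^+ m.+1 + 4 / gamma <= 2 ^+ L0.
  exact/ltW/upper_nthrootP.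
have g4 : 0 <= 4 / gamma by rewrite divr_ge0 ?ltW.
have cb0 : 0 <= c * (8 * (1 + 2 * gamma)) ^+ m.+1.
  by rewrite mulr_ge0 ?exprn_ge0 //; lra.
pose Gam := Num.bound gamma.
have Gb : gamma < Gam%:R by apply: archi_boundP; exact: ltW.
pose K1 : R := 1 + (L0 + 3 * L1 + Gam + 1)%:R * (2 * c) *
      (Delta ^+ L0 * 4 `^ (ln Delta / ln 2 * L1%:R)).
have K1_ge0 : 0 <= K1.
  rewrite /K1 addr_ge0 // mulr_ge0 // ?mulr_ge0 ?powR_ge0 ?exprn_ge0 //; lra.
exists (approx_program L0 L1), (3000 * K1 ^+ 6); split.
  by rewrite mulr_ge0 ?exprn_ge0.
move=> G eps FG heps; have /andP[e0 e1] := heps.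
have [j [j0 j1 /andP[ej1 ej2]]] := first_digit heps.
set n := nv G; have n0 : (0 < n)%N := nv_gt0 G.
set t := trunc_log 2 n; pose l := (L0 + L1 * (t.+1 + j))%N.
have n1 : 1 <= n%:R :> R by rewrite ler1n.
have tn : (2 ^ t <= n)%N by apply: trunc_logP.
have nt : (n < 2 ^ t.+1)%N by apply: trunc_log_ltn.
set x := n%:R / eps.
have nx : n%:R <= x by rewrite /x ler_pdivlMr // ler_piMr //; lra.
have x1 : 1 <= x by lra.
have xk : x <= 2 ^+ (t.+1 + j).
  rewrite /x exprD; apply: ler_pM => //; first by rewrite invr_ge0 ltW.
    by rewrite -natrX ler_nat ltnW.
  by rewrite -[eps^-1]mul1r ler_pdivrMr // mulrC.
have L1m : (2 * m.+1 <= L1)%N by rewrite /L1 mulnC leq_mul2l leq_addr orbT.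
have l1 : 2 ^+ L0 * x ^+ (2 * m.+1) <= 2 ^+ l.
  rewrite /l exprD ler_wpM2l ?exprn_ge0 //.
  rewrite [(L1 * _)%N]mulnC [2 ^+ (_ * L1)]exprM.
  apply: (@le_trans _ _ ((2 ^+ (t.+1 + j)) ^+ (2 * m.+1))).
    by rewrite lerXn2r ?nnegrE ?exprn_ge0 //; lra.
  by apply: ler_weXn2l => //; lra.
have xm : 1 <= x ^+ (2 * m.+1) by apply: exprn_ege1.
have hl : c * (8 * (1 + 2 * gamma) * x ^+ 2) ^+ m.+1 <= 2 ^+ l.
  apply: le_trans l1; rewrite exprMn -exprM mulrA ler_wpM2r //; lra.
have hl2 : 4 / gamma * x <= 2 ^+ l.
  apply: le_trans l1; apply: ler_pM => //; [lra | lra |].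
  by rewrite -[X in X <= _]expr1; apply: ler_weXn2l.
have la : a * ln (nv G)%:R <= l%:R.
  apply: (@le_trans _ _ (`|a| * t.+1%:R)).
    apply: (@le_trans _ _ (`|a| * ln n%:R)).
      by rewrite ler_wpM2r ?ln_ge0 // ler_norm.
    by rewrite ler_wpM2l // ln_le_trunc_log.
  apply: (@le_trans _ _ (L1%:R * t.+1%:R)).
    rewrite ler_wpM2r //; apply: (@le_trans _ _ (Num.bound `|a|)%:R).
      by rewrite ltW // archi_boundP.
    rewrite ler_nat; apply: leq_trans (leq_addl 2 _) _.
    exact: leq_pmull.
  rewrite -natrM ler_nat; apply: leq_trans (leq_addl L0 _).
  by rewrite leq_mul2l leq_addr orbT.
have L1_gt0 : (0 < L1)%N by rewrite muln_gt0.
have l0 : (0 < l)%N by rewrite addn_gt0 muln_gt0 L1_gt0 orbT.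
have hsaw v := hF G FG v l la.
have hwalk (v : 'I_(nv G)) (A : {set 'I_(nv G)}) : v \notin A ->
    (num_walks l v A)%:R <= c * Delta ^+ l.
  move=> vA; apply: le_trans (hsaw v); rewrite ler_nat.
  apply: leq_trans (num_walks_le_saw l vA) _.
  by rewrite big_nat_recr //= leq_addl.
(* The 1 counts the root, that is, the walk of length 0, which the sum in [connective_bound] leaves
   out. *)
pose S := (1 + Num.truncn (c * Delta ^+ l))%N.
have cD1 : 1 <= c * Delta ^+ l.
  by rewrite -[1]mulr1 ler_pM // exprn_ege1.
have SE : S%:R <= 2 * c * Delta ^+ l.
  have /andP[h _] := @truncn_itv R (c * Delta ^+ l) ltac:(lra).
  by rewrite /S natrD; lra.
have hS (v : 'I_(nv G)) (A : {set 'I_(nv G)}) :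
    v \notin A -> (tree_size l v A <= S)%N.
  move=> vA; apply: leq_trans (tree_size_le l vA) _.
  rewrite leq_add2l -(ler_nat R).
  have /andP[_ h] := @truncn_itv R (c * Delta ^+ l) ltac:(lra).
  have := le_lt_trans (hsaw v) h; rewrite ltr_nat ltnS => h'.
  by rewrite ler_nat.
pose g := `|Num.floor (gamma * 2 ^+ l)|%N.
have p2l : 0 < 2 ^+ l :> R by rewrite exprn_gt0.
have gl1 : 1 <= gamma * 2 ^+ l.
  have h := ler_wpM2l (ltW gm0) hl2.
  have e4 : gamma * (4 / gamma * x) = 4 * x by field; rewrite gt_eqF.
  by move: h; rewrite e4; apply: le_trans; lra.
have gE : Num.floor (gamma * 2 ^+ l) = g%:Z.
  by rewrite /g gez0_abs // floor_ge0; lra.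
have /andP[gf1 gf2] : g%:R <= gamma * 2 ^+ l < g%:R + 1.
  have := floor_itv (gamma * 2 ^+ l); rewrite gE.
  by rewrite intrD mulr1z -[(Posz g)%:~R]/(g%:R).
have g_gt0 : 0 < g%:R :> R.
  rewrite ltr0n lt0n; apply/negP => /eqP g0; move: gf2; rewrite g0; lra.
set q : R := g%:R / (2 ^ l)%N%:R.
have hh : (2 ^ l)%N%:R = 2 ^+ l :> R by rewrite natrX.
have q0 : 0 < q by rewrite /q divr_gt0 // hh.
have qle : q <= gamma by rewrite /q hh ler_pdivrMr.
set eta := eps / (4 * n%:R).
have eta0 : 0 < eta by rewrite /eta divr_gt0 // mulr_gt0 //; lra.
have eta1 : eta <= 1 by rewrite /eta ler_pdivrMr ?mulr_gt0 //; lra.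
(* Rounding down loses less than 1 from gamma 2^l, and gamma 2^l >= 4 n / eps = 1 / eta by the
   choice of [L0]. *)
have qge : (1 - eta) * gamma <= q.
  rewrite /q hh ler_pdivlMr //.
  have : 1 <= eta * (gamma * 2 ^+ l).
    apply: (@le_trans _ _ (eta * (gamma * (4 / gamma * x)))).
      by apply: eq_ler; rewrite /eta /x; field; rewrite !gt_eqF //; lra.
    by rewrite ler_wpM2l ?(ltW eta0) // ler_wpM2l ?(ltW gm0).
  by move: gf2; lra.
set B := (l + Gam + n)%N.
have hB : (2 ^ l + g * nv G <= 2 ^ B)%N.
  have gG : (g <= Gam * 2 ^ l)%N.
    rewrite -(ler_nat R) natrM hh; apply: le_trans gf1 _.
    by rewrite ler_wpM2r ?(ltW p2l) // ltW.
  rewrite /B -addnA expnD.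
  apply: (@leq_trans (2 ^ l * (1 + Gam * n))).
    by rewrite mulnDr muln1 leq_add2l mulnA [(2 ^ l * _)%N]mulnC leq_mul2r gG orbT.
  rewrite leq_mul2l expnD; apply/orP; right.
  apply: leq_trans (leq_mul (ltn_expl Gam (isT : 1 < 2)%N)
                            (ltn_expl n (isT : 1 < 2)%N)).
  by rewrite add1n mulSn mulnS addSn ltnS addnA leq_addl.
have [ti hti heval] := @runs_main (digits gamma eps) L0 L1 G g l j B S
  L1_gt0 erefl gE j0 j1 hB (leq_addl _ _)
  ltac:(by rewrite /B -addnA leq_addr) isT hS.
have /andP[z0 _] := @outer_frac_bounds G g (2 ^ l) l (enum 'I_(nv G))
  ltac:(by rewrite expn_gt0).
exists (outer_frac g (2 ^ l) l (enum 'I_(nv G))).1,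
  (outer_frac g (2 ^ l) l (enum 'I_(nv G))).2, ti; split=> //.
- apply: (@approximates_combine R G gamma q eps) => //.
    by rewrite (ltW q0).
  have := @outer_frac_approx R G g (2 ^ l) l q eta (enum 'I_(nv G))
    ltac:(by rewrite expn_gt0) erefl ltac:(lra) (enum_uniq _).
  have -> : [set x in enum 'I_(nv G)] = [set: 'I_(nv G)].
    by apply/setP => v; rewrite !inE mem_enum.
  rewrite sub_partitionT size_enum_ord; apply=> v A vA.
  by apply: (trunc_ratio_error (gamma := gamma) (Delta := Delta) (c := c) (m := m));
    rewrite ?q0 ?qle //; [lra | exact: hwalk].
- apply: (@le_trans _ _ (3000 * (((l + Gam + n) * S * n).+1)%:R ^+ 6)).
    by rewrite -natrX -natrM ler_nat.
  rewrite -mulrA ler_wpM2l //.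
  have hU := @time_bound R n S Gam L0 L1 t j l c Delta eps n0 tn heps ej2
    D1 c1 erefl SE.
  set E := 2 + ln Delta / ln 2 * L1%:R.
  have l2 : 0 < ln (2 : R) by rewrite ln_gt0 // ltr1n.
  have th0 : 0 <= ln Delta / ln 2 := divr_ge0 (ln_ge0 D1) (ltW l2).
  have E0 : 0 <= E by rewrite /E addr_ge0 // mulr_ge0.
  have xE : 1 <= x `^ E by rewrite -(powRr0 x); apply: ler_powR.
  have hU' : (((l + Gam + n) * S * n).+1)%:R <= K1 * x `^ E.
    have one_le (A y : R) : 1 <= y -> 1 + A * y <= (1 + A) * y.
      by move=> y1; rewrite mulrDl mul1r lerD2r.
    exact: le_trans hU (one_le _ _ xE).
  apply: (@le_trans _ _ ((K1 * x `^ E) ^+ 6)).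
    by rewrite lerXn2r ?nnegrE // mulr_ge0 ?powR_ge0.
  rewrite exprMn ler_wpM2l ?exprn_ge0 //.
  rewrite -powR_mulrn ?powR_ge0 // -powRrM; apply: ler_powR => //.
  exact: exponent_le.
Qed.

(** [delta] makes the O in the exponent meaningful: sqrt (gamma Delta) ln Delta tends to 0 as Delta
    tends to 1, or as gamma tends to 0 with Delta fixed, while reading the graph always takes time
    growing with n. [C] depends on [a] and [delta] only; [c] enters the constant factor and not the
    exponent. *)
Theorem theorem1p3 (R : realType) (a delta : R) (hdelta : 0 < delta) :
  exists C : R, 0 < C /\
  forall (Delta gamma c : R) (F : sgraph -> Prop),
  0 < Delta -> 0 < gamma -> connective_bound a c Delta F ->
  exists P : program,
    is_fptas F gamma P /\
    (1 + delta <= Delta -> delta <= gamma * Delta ->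
     exists K : R,
       approx_scheme F gamma P
         (fun n eps =>
            K * (n%:R / eps) `^ (C * (Num.sqrt (gamma * Delta) * ln Delta)))).
Proof.
exists (exponent_const a delta); split; first exact: exponent_const_gt0.
move=> Delta gamma c F D0 g0 hF.
(* Raising [Delta] only weakens [connective_bound]. [Delta'] lies in the range of [scheme_exists],
   and it is [Delta] itself under the hypotheses of the second claim, so one program serves both
   claims. *)
pose Delta' := Num.max Delta (Num.max (1 + delta) (delta / gamma)).
have D1' : 1 + delta <= Delta' by rewrite /Delta' !le_max lexx orbT.
have D2' : delta <= gamma * Delta'.
  by rewrite mulrC -ler_pdivrMr // /Delta' !le_max lexx !orbT.
have DD : Delta <= Delta' by rewrite /Delta' le_max lexx.
have hF' : connective_bound a (Num.max c 1) Delta' F.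
  move=> G FG v l hl; apply: le_trans (hF G FG v l hl) _.
  apply: (@le_trans _ _ (Num.max c 1 * Delta ^+ l)).
    by rewrite ler_wpM2r ?exprn_ge0 ?(ltW D0) // le_max lexx.
  rewrite ler_wpM2l ?le_max ?ler01 ?orbT // lerXn2r ?nnegrE //; lra.
have c1 : 1 <= Num.max c 1 by rewrite le_max lexx orbT.
have [P [K [K0 hP]]] := scheme_exists hdelta D1' g0 D2' c1 hF'.
exists P; split.
  set E := (exponent_const _ _ * _) in hP.
  exists K, (Num.bound `|E|) => G eps FG heps.
  have [num [den [t [h1 h2 h3 h4]]]] := hP G eps FG heps.
  exists num, den, t; split=> //; apply: le_trans h4 _.
  rewrite -mulrA ler_wpM2l // -exprMn.
  have /andP[e0 e1] := heps.
  have x1 : 1 <= (nv G)%:R / eps.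
    rewrite ler_pdivlMr // mul1r (le_trans e1) // ler1n; exact: nv_gt0.
  rewrite -powR_mulrn; last by lra.
  by apply: ler_powR => //; apply: le_trans (ler_norm _) (ltW (archi_boundP _)).
move=> hD hgD; exists K.
have DE : Delta' = Delta.
  apply/max_idPl; rewrite ge_max hD /= ler_pdivrMr // mulrC //.
by rewrite -DE.
Qed.
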